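(* Let $\mathbf T=(T_1,\ldots,T_m)$ be a tuple of invertible real $d\times d$ matrices with $\|T_i\|<1$ for $1\le i\le m$, and let $k\in\{1,\ldots,d-1\}$. For every $s\ge0$ and $W\in G(d,k)$, $$P(\mathbf T,W,s)=\lim_{n\to\infty}\frac1n\log\sum_{I\in\Sigma_n}\varphi^s(T_I^*P_W)$$ (in particular the limit on the right-hand side exists in $[-\infty,\infty)$).
   Context: $d\ge2$; $\|\cdot\|$ is the operator norm induced by the Euclidean norm. $\Sigma_0=\{\emptyset\}$, $\Sigma_n=\{1,\ldots,m\}^n$, $\Sigma_*=\bigcup_{n\ge0}\Sigma_n$; $T_I=T_{i_1}\cdots T_{i_n}$ for $I=i_1\cdots i_n$, $T_\emptyset=\mathrm{Id}$, $T_I^*=(T_I)^*$ is the transpose. $G(d,k)$ is the set of $k$-dimensional linear subspaces of $\mathbb R^d$; $P_W$ is the orthogonal projection onto $W$. Singular value function: for a real $d\times d$ matrix $A$ with singular values $\alpha_1(A)\ge\cdots\ge\alpha_d(A)$, $\varphi^s(A)=\alpha_1(A)\cdots\alpha_j(A)\alpha_{j+1}(A)^{s-j}$ with $j=\lfloor s\rfloor$ if $0\le s<d$ (convention $0^0=1$), and $\varphi^s(A)=|\det A|^{s/d}$ if $s\ge d$. Define $\psi_W^s(I)=\sup_{K\in\Sigma_*}\varphi^s(T_I^*P_{T_K^*W})$ for $I\in\Sigma_*$ and $P(\mathbf T,W,s)=\lim_{n\to\infty}\frac1n\log\sum_{I\in\Sigma_n}\psi_W^s(I)$ (the limit exists in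 $[-\infty,\infty)$ since $\psi_W^s$ is submultiplicative). Convention $\log0=-\infty$. *)

(* Defs.v *)
From mathcomp Require Import all_boot all_order all_algebra.
From mathcomp Require Import polyrcf.
From mathcomp Require Import all_classical all_reals all_analysis.
Set Implicit Arguments.
Unset Strict Implicit.
Unset Printing Implicit Defensive.
Import Order.TTheory GRing.Theory Num.Theory.
Local Open Scope classical_set_scope.
Local Open Scope ring_scope.

(* Vectors of R^d are column vectors, and matrices act on them by left
   multiplication. *)

Definition enorm (R : realType) (d : nat) (x : 'cV[R]_d) : R :=
  Num.sqrt (\sum_(i < d) x i 0 ^+ 2).

Definition opnorm (R : realType) (d : nat) (A : 'M[R]_d) : R :=
  sup [set enorm (A *m x) | x in [set x : 'cV[R]_d | enorm x <= 1]].

(* [rootsR] lists each real root of a polynomial once; [mup] is the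
   multiplicity of a root. *)
Definition eigenvalues_mult (R : realType) (d : nat) (A : 'M[R]_d) : seq R :=
  flatten [seq nseq (mup x (char_poly A)) x | x <- rootsR (char_poly A)].

Definition singular_values (R : realType) (d : nat) (A : 'M[R]_d) : seq R :=
  sort >=%R [seq Num.sqrt x | x <- eigenvalues_mult (A^T *m A)].

(* Indices start from 0: [singular_value A i] is alpha_{i+1}(A). *)
Definition singular_value (R : realType) (d : nat) (A : 'M[R]_d) (i : nat) : R :=
  nth 0 (singular_values A) i.

(* The library's real power satisfies 0 `^ 0 = 1. *)
Definition svf (R : realType) (d : nat) (s : R) (A : 'M[R]_d) : R :=
  if s < d%:R then
    let j := Num.truncn s in
    (\prod_(i < j) singular_value A i) * singular_value A j `^ (s - j%:R)
  else `|\det A| `^ (s / d%:R).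

Definition ortho_compl (R : realType) (d : nat) (W : {vspace 'cV[R]_d}) :
    {vspace 'cV[R]_d} :=
  (\bigcap_(w <- vbasis W)
     lker (linfun (mulmx w^T : 'cV[R]_d -> 'M[R]_(1, 1))))%VS.

(* Matrix, in the canonical basis, of the projection onto W along its
   orthogonal complement. *)
Definition ortho_proj (R : realType) (d : nat) (W : {vspace 'cV[R]_d}) :
    'M[R]_d :=
  \matrix_(i, j) (daddv_pi W (ortho_compl W) (delta_mx j 0)) i 0.

Definition mx_image (R : realType) (d : nat) (A : 'M[R]_d)
    (W : {vspace 'cV[R]_d}) : {vspace 'cV[R]_d} :=
  (linfun (mulmx A : 'cV[R]_d -> 'cV[R]_d) @: W)%VS.

Definition word_prod (R : realType) (d m : nat) (T : 'I_m -> 'M[R]_d)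
    (I : seq 'I_m) : 'M[R]_d :=
  \big[mulmx/1%:M]_(i <- I) T i.

(* Words of arbitrary length are sequences over 'I_m, and words of length n
   are n-tuples. *)
Definition psi (R : realType) (d m : nat) (T : 'I_m -> 'M[R]_d)
    (W : {vspace 'cV[R]_d}) (s : R) (I : seq 'I_m) : \bar R :=
  ereal_sup [set (svf s ((word_prod T I)^T *m
                         ortho_proj (mx_image (word_prod T K)^T W)))%:E
            | K in [set: seq 'I_m]].

(* [lne] is the extended logarithm, with lne 0 = -oo. The terms of index 0 of
   the next two sequences are irrelevant. *)
Definition psi_seq (R : realType) (d m : nat) (T : 'I_m -> 'M[R]_d)
    (W : {vspace 'cV[R]_d}) (s : R) (n : nat) : \bar R :=
  ((n%:R^-1)%:E * lne (\sum_(I : n.-tuple 'I_m) psi T W s I)%E)%E.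

Definition phi_seq (R : realType) (d m : nat) (T : 'I_m -> 'M[R]_d)
    (W : {vspace 'cV[R]_d}) (s : R) (n : nat) : \bar R :=
  ((n%:R^-1)%:E *
   lne (\sum_(I : n.-tuple 'I_m)
          svf s ((word_prod T I)^T *m ortho_proj W))%:E)%E.

Definition pressure (R : realType) (d m : nat) (T : 'I_m -> 'M[R]_d)
    (W : {vspace 'cV[R]_d}) (s : R) : \bar R :=
  limn (psi_seq T W s).

(* Main.v *)
Require Import Defs.
From mathcomp Require Import all_boot all_order all_algebra.
From mathcomp Require Import all_classical all_reals all_analysis.
From mathcomp Require Import fingroup perm polyrcf complex.
From mathcomp Require Import ring lra.
Import Order.TTheory GRing.Theory Num.Theory.
Import numFieldNormedType.Exports.
Local Open Scope classical_set_scope.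
Local Open Scope ring_scope.
Set Implicit Arguments.
Unset Strict Implicit.
Unset Printing Implicit Defensive.

(** Write [phi K I] for the singular value function of [T_I^T P], where [P] is
    the projection onto [T_K^T W]. Taking [K] empty shows that the sums of
    [phi [::] I] are at most the sums of [psi I = sup_K phi K I], and the point
    is to prove the converse inequality up to a factor [C * expR (e * n)], for
    every [e > 0].

    The supremum over the infinitely many words [K] is reduced to a maximum
    over finitely many of them. The product of the [j] largest singular values
    of a matrix is comparable with the norm of its [j]-th compound matrix
    ([singular_value_prod]), so that the singular value function is comparable
    with [N_j(A)^a * N_j'(A)^b], where [N_j] sums the absolute values of the
    [j]-minors ([svf_minor_svf]). For natural exponents such a product, applied
    to [A P], is up to constants a polynomial in the entries of [A] and [P],
    that is, a finite sum of functions [u(P) v(A)]. The entries of the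
    projections are bounded by 1, so the vectors [u(P)] form a bounded subset of
    a finite-dimensional space, and finitely many of them dominate all the
    others uniformly in [A] ([separable_dominated_sum]). Real exponents are
    approximated by rational ones. When [s <= \dim W], all the minor norms
    involved lie between [expR (- (L * (n + 1)))] and [expR (L * (n + 1))]
    ([minor_norm_word_restr]), so the error is a factor [expR (e * n)]
    ([minor_svf_dominated]).

    For a fixed word [F], the projection onto [T_F^T W] is [T_F^T P_W] times a
    constant matrix, hence [phi F I] is at most a constant times
    [phi [::] (F ++ I)], and deleting the last [size F] letters of [F ++ I]
    costs another constant. This proves the converse inequality
    ([word_sum_sup_le]). The sums of [psi] are submultiplicative up to a
    constant, so Fekete's lemma gives their growth rate, and the sums of
    [phi [::]] have the same one ([abstract_pressure]).

    When [s > \dim W], every [phi K I] is zero and both limits are [-oo]. *)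

(** * Minors and the Cauchy-Binet formula *)

Section CauchyBinet.

Lemma det_rowsub_perm (R : comRingType) (d j : nat) (f : 'I_j -> 'I_d)
    (s : 'S_j) (B : 'M[R]_(d, j)) :
  \det (rowsub (f \o s) B) = (-1) ^+ s * \det (rowsub f B).
Proof.
have -> : rowsub (f \o s) B = row_perm s (rowsub f B).
  by apply/matrixP => a b; rewrite !mxE.
by rewrite row_permE det_mulmx det_perm.
Qed.

Lemma det_mulmx_expand (R : comRingType) (d j : nat) (A : 'M[R]_(j, d))
    (B : 'M[R]_(d, j)) :
  \det (A *m B) =
  \sum_(f : {ffun 'I_j -> 'I_d}) (\prod_i A i (f i)) * \det (rowsub f B).
Proof.
rewrite /determinant.
under eq_bigr => s _.
  under eq_bigr => i _ do rewrite mxE.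
  rewrite bigA_distr_bigA /= big_distrr /=.
  over.
rewrite exchange_big; apply: eq_bigr => f _.
rewrite big_distrr; apply: eq_bigr => s _ /=.
rewrite big_split /= mulrCA; congr (_ * (_ * _)).
by apply: eq_bigr => i _; rewrite !mxE.
Qed.

(** Index families are arbitrary functions instead of increasing ones, so each
    [j]-subset of columns is counted [j`!] times; this is the factor on the
    left. *)
Lemma cauchy_binet (R : comRingType) (d j : nat) (A : 'M[R]_(j, d))
    (B : 'M[R]_(d, j)) :
  j`!%:R * \det (A *m B) =
  \sum_(f : {ffun 'I_j -> 'I_d}) \det (colsub f A) * \det (rowsub f B).
Proof.
have perm_expand (s : 'S_j) : \det (A *m B) =
    \sum_(f : {ffun 'I_j -> 'I_d})
       (-1) ^+ s * (\prod_i A i (f (s i))) * \det (rowsub f B).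
  pose h (t : 'S_j) (f : {ffun 'I_j -> 'I_d}) := [ffun i => f (t i)].
  have hK t : cancel (h t) (h t^-1%g).
    by move=> f; apply/ffunP => i; rewrite !ffunE permKV.
  rewrite det_mulmx_expand (reindex (h s)) /=; last first.
    exists (h s^-1%g) => f _; first exact: hK.
    by apply/ffunP => i; rewrite !ffunE permK.
  apply: eq_bigr => f _.
  have -> : rowsub (h s f) B = rowsub (f \o s) B.
    by apply: eq_rowsub => i; rewrite ffunE.
  rewrite det_rowsub_perm mulrCA mulrA; congr (_ * _ * _).
  by apply: eq_bigr => i _; rewrite ffunE.
rewrite -(card_Sn j) mulr_natl.
rewrite -sumr_const (eq_bigr _ (fun s _ => perm_expand s)) exchange_big /=.
apply: eq_bigr => f _; rewrite -mulr_suml; congr (_ * _).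
by apply: eq_bigr => s _; congr (_ * _); apply: eq_bigr => i _; rewrite mxE.
Qed.

End CauchyBinet.

Section MinorNorm.
Context {R : numFieldType}.

(** The entrywise 1-norm of the [j]-th compound matrix, the matrix of the
    action of [A] on the [j]-th exterior power. *)
Definition minor_norm (d j : nat) (A : 'M[R]_d) : R :=
  \sum_(f : {ffun 'I_j -> 'I_d}) \sum_(g : {ffun 'I_j -> 'I_d})
    `|\det (mxsub f g A)|.

Lemma minor_norm_ge0 (d j : nat) (A : 'M[R]_d) : 0 <= minor_norm j A.
Proof. by apply: sumr_ge0 => f _; apply: sumr_ge0. Qed.

Lemma minor_le_minor_norm (d j : nat) (A : 'M[R]_d) (f g : 'I_j -> 'I_d) :
  `|\det (mxsub f g A)| <= minor_norm j A.
Proof.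
rewrite /minor_norm (bigD1 (finfun f)) //= (bigD1 (finfun g)) //= mxsub_ffun.
by rewrite -addrA ler_wpDr // addr_ge0 // sumr_ge0 // => h _; exact: sumr_ge0.
Qed.

Lemma ler_minor_mul (d j : nat) (A B : 'M[R]_d) (f g : 'I_j -> 'I_d) :
  `|\det (mxsub f g (A *m B))| <=
  \sum_(h : {ffun 'I_j -> 'I_d})
    `|\det (mxsub f h A)| * `|\det (mxsub h g B)|.
Proof.
have fact_ge1 : 1 <= `|j`!%:R : R| by rewrite normr_nat ler1n fact_gt0.
apply: le_trans (ler_peMl (normr_ge0 _) fact_ge1) _.
rewrite -normrM mxsub_mul cauchy_binet; apply: le_trans (ler_norm_sum _ _ _) _.
by apply: ler_sum => h _; rewrite normrM -mxsub_comp -mxsub_comp.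
Qed.

Lemma minor_norm_mul (d j : nat) (A B : 'M[R]_d) :
  minor_norm j (A *m B) <= minor_norm j A * minor_norm j B.
Proof.
have step : minor_norm j (A *m B) <=
    \sum_(f : {ffun 'I_j -> 'I_d}) \sum_(g : {ffun 'I_j -> 'I_d})
      \sum_(h : {ffun 'I_j -> 'I_d})
        `|\det (mxsub f h A)| * `|\det (mxsub h g B)|.
  by apply: ler_sum => f _; apply: ler_sum => g _; exact: ler_minor_mul.
apply: le_trans step _; rewrite /minor_norm mulr_suml; apply: ler_sum => f _.
rewrite exchange_big mulr_suml /=; apply: ler_sum => h _.
rewrite -mulr_sumr ler_wpM2l //.
rewrite [X in _ <= X](bigD1 h) //= lerDl.
by rewrite sumr_ge0 // => h' _; rewrite sumr_ge0.
Qed.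

Lemma minor_norm_tr (d j : nat) (A : 'M[R]_d) :
  minor_norm j A^T = minor_norm j A.
Proof.
rewrite /minor_norm exchange_big; apply: eq_bigr => f _; apply: eq_bigr => g _.
by rewrite -trmx_mxsub det_tr.
Qed.

Lemma ler_det_fact (j : nat) (M : 'M[R]_j) :
  (forall i i', `|M i i'| <= 1) -> `|\det M| <= j`!%:R.
Proof.
move=> M1; apply: le_trans (ler_norm_sum _ _ _) _.
rewrite -(card_Sn j) -sumr_const; apply: ler_sum => s _.
rewrite normrM normrX normrN1 expr1n mul1r normr_prod.
rewrite [X in _ <= X](_ : _ = \prod_(i < j) 1); last by rewrite big1.
by apply: ler_prod => i _; rewrite normr_ge0 M1.
Qed.

Definition minor_bound (d j : nat) : R :=
  (#|{ffun 'I_j -> 'I_d}| * (#|{ffun 'I_j -> 'I_d}| * j`!))%N%:R.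

Lemma minor_norm_le (d j : nat) (A : 'M[R]_d) :
  (forall i i', `|A i i'| <= 1) -> minor_norm j A <= minor_bound d j.
Proof.
move=> A1; rewrite /minor_norm /minor_bound natrM mulr_natl -sumr_const.
apply: ler_sum => f _; rewrite natrM mulr_natl -sumr_const.
by apply: ler_sum => g _; apply: ler_det_fact => i i'; rewrite mxE.
Qed.

(** An idempotent satisfies [N <= N * N]. *)
Lemma minor_norm_idem_ge1 (d j : nat) (P : 'M[R]_d) :
  P *m P = P -> minor_norm j P != 0 -> 1 <= minor_norm j P.
Proof.
move=> PP N0; have := minor_norm_mul j P P; rewrite PP.
by rewrite ler_pMl // lt_def N0 minor_norm_ge0.
Qed.

Lemma minor_norm_eq0 (d j : nat) (A : 'M[R]_d) :
  (\rank A < j)%N -> minor_norm j A = 0.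
Proof.
move=> rA; rewrite /minor_norm big1 // => f _; rewrite big1 // => g _.
apply/eqP; rewrite normr_eq0; apply: contraTT rA => det_neq0.
rewrite -leqNgt -[X in (X <= _)%N](mxrank_unit (_ : mxsub f g A \in unitmx)).
  rewrite mxsubrc; apply: leq_trans (mxrankS (rowsub_sub _ _)) _.
  rewrite -mxrank_tr trmx_mxsub; apply: leq_trans (mxrankS (rowsub_sub _ _)) _.
  by rewrite mxrank_tr.
by rewrite unitmxE unitfE.
Qed.

Lemma minor_norm_neq0 (d j : nat) (A : 'M[R]_d) :
  (j <= \rank A)%N -> minor_norm j A != 0.
Proof.
move=> jA; apply/eqP => A0.
set r := \rank A in jA.
have rd : (r <= d)%N := rank_leq_col A.
have pidE : pid_mx r = invmx (col_ebase A) *m A *m invmx (row_ebase A).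
  rewrite -{2}(mulmx_ebase A) -!mulmxA mulmxV ?row_ebase_unit // mulmx1.
  by rewrite mulKmx ?col_ebase_unit.
have: minor_norm j (pid_mx r : 'M[R]_d) <= 0.
  rewrite pidE; apply: le_trans (minor_norm_mul _ _ _) _.
  suff -> : minor_norm j (invmx (col_ebase A) *m A) = 0 by rewrite mul0r.
  apply/le_anti/andP; split; last exact: minor_norm_ge0.
  by apply: le_trans (minor_norm_mul _ _ _) _; rewrite A0 mulr0.
pose f (i : 'I_j) : 'I_d := widen_ord (leq_trans jA rd) i.
have := minor_le_minor_norm (pid_mx r : 'M[R]_d) f f.
have -> : mxsub f f (pid_mx r : 'M[R]_d) = 1%:M.
  apply/matrixP => a b; rewrite !mxE /= (leq_trans (ltn_ord a) jA) andbT.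
  by rewrite -val_eqE.
rewrite det1 normr1 => le1 le0; have := le_trans le1 le0.
by rewrite ler10.
Qed.

End MinorNorm.

Lemma minor_norm_map (K L : numFieldType) (h : {rmorphism K -> L})
    (hnorm : forall x, `|h x| = h `|x|) (d j : nat) (A : 'M[K]_d) :
  minor_norm j (map_mx h A) = h (minor_norm j A).
Proof.
rewrite /minor_norm rmorph_sum; apply: eq_bigr => f _.
rewrite rmorph_sum; apply: eq_bigr => g _.
by rewrite -hnorm -det_map_mx map_mxsub.
Qed.

(** By Cauchy-Binet, the principal minors of the Gram matrix [A^T A] are sums
    of squares of minors of [A]. *)
Lemma minor_norm_gram (R : rcfType) (d j : nat) :
  exists2 c : R, 0 < c &
    forall A : 'M[R]_d, minor_norm j A ^+ 2 <= c * minor_norm j (A^T *m A).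
Proof.
set n := #|{ffun 'I_j -> 'I_d}|.
exists ((n * n)%:R ^+ 2 * j`!%:R + 1).
  by rewrite ltr_wpDl // mulr_ge0 // exprn_ge0.
move=> A.
have gramN0 := minor_norm_ge0 j (A^T *m A).
have minor_sq (f g : {ffun 'I_j -> 'I_d}) :
    `|\det (mxsub f g A)| <= Num.sqrt (j`!%:R * minor_norm j (A^T *m A)).
  rewrite -sqrtr_sqr ler_sqrt ?mulr_ge0 //.
  apply: le_trans (_ : j`!%:R * `|\det (mxsub g g (A^T *m A))| <= _); last first.
    by rewrite ler_wpM2l // minor_le_minor_norm.
  rewrite -[j`!%:R]ger0_norm // -normrM mxsub_mul cauchy_binet.
  apply: le_trans _ (ler_norm _).
  have sumE : \sum_(h : {ffun 'I_j -> 'I_d})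
      \det (colsub h (rowsub g A^T)) * \det (rowsub h (colsub g A)) =
      \sum_(h : {ffun 'I_j -> 'I_d}) \det (mxsub h g A) ^+ 2.
    apply: eq_bigr => h _; rewrite -mxsub_comp -mxsub_comp -trmx_mxsub det_tr.
    by rewrite expr2.
  rewrite sumE (bigD1 f) //= lerDl sumr_ge0 // => h _; exact: sqr_ge0.
have sumB : minor_norm j A <=
    (n * n)%:R * Num.sqrt (j`!%:R * minor_norm j (A^T *m A)).
  rewrite natrM -mulrA [X in _ <= X]mulr_natl -sumr_const; apply: ler_sum => f _.
  rewrite mulr_natl -sumr_const; apply: ler_sum => g _; exact: minor_sq.
have := lerXn2r 2 (minor_norm_ge0 j A) (le_trans (minor_norm_ge0 j A) sumB) sumB.
rewrite exprMn sqr_sqrtr ?mulr_ge0 // mulrA => /le_trans; apply.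
by rewrite ler_wpM2r // lerDl.
Qed.

(** * Singular values and minors *)

Lemma char_poly_conj (F : fieldType) (n : nat) (P D : 'M[F]_n) :
  P \in unitmx -> char_poly (invmx P *m D *m P) = char_poly D.
Proof.
move=> Pu; rewrite /char_poly.
pose Q := map_mx polyC P; pose Qi := map_mx polyC (invmx P).
have QiQ : Qi *m Q = 1%:M by rewrite -map_mxM mulVmx // map_mx1.
have -> : char_poly_mx (invmx P *m D *m P) = Qi *m char_poly_mx D *m Q.
  rewrite /char_poly_mx mulmxBr mulmxBl !map_mxM -/Q -/Qi; congr (_ - _).
  by rewrite scalar_mxC -mulmxA QiQ mulmx1.
by rewrite !det_mulmx mulrAC -det_mulmx QiQ det1 mul1r.
Qed.

Lemma unitary_entry_le1 (C : numClosedFieldType) (n : nat) (P : 'M[C]_n) i l :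
  P \is unitarymx -> `|P i l| <= 1.
Proof.
move=> /unitarymxP /matrixP /(_ i i); rewrite !mxE eqxx => sum1.
rewrite -(@expr_le1 _ 2) // -[X in _ <= X]sum1 (bigD1 l) //= !mxE -normCK.
by rewrite lerDl sumr_ge0 // => l' _; rewrite !mxE -normCK exprn_ge0.
Qed.

Lemma normC_real (R : realType) (x : R) :
  `|(x%:C)%C| = (`|x|%:C)%C.
Proof. by rewrite normc_def /= expr0n addr0 sqrtr_sqr. Qed.

(** Diagonalize the symmetric matrix [A^T A] by a unitary matrix over [R[i]]:
    the entries of a unitary matrix are bounded by 1, so the conjugation
    changes [minor_norm] by a bounded factor only. *)
Lemma gram_diagonalization (R : realType) (d : nat) (A : 'M[R]_d) :
  exists l : 'I_d -> R,
  [/\ forall i, 0 <= l i,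
      char_poly (A^T *m A) = \prod_(i < d) ('X - (l i)%:P),
      forall j, minor_norm j (diag_mx (\row_i l i)) <=
                minor_bound d j ^+ 2 * minor_norm j (A^T *m A)
    & forall j, minor_norm j (A^T *m A) <=
                minor_bound d j ^+ 2 * minor_norm j (diag_mx (\row_i l i))].
Proof.
pose toC : {rmorphism R -> R[i]} := real_complex R.
pose S := A^T *m A; pose Sc := map_mx toC S.
pose P := spectralmx Sc; pose X := spectral_diag Sc.
have toC_conj x : (toC x)^* = toC x by apply/CrealP; rewrite complex_real.
have Pu : P \is unitarymx := spectral_unitarymx Sc.
have Punit : P \in unitmx := spectral_unit Sc.
have PV : invmx P = (map_mx Num.conj P^T) by rewrite invmx_unitary // map_trmx.
have ScH : map_mx Num.conj Sc^T = Sc.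
  apply/matrixP => a b; rewrite !mxE toC_conj.
  by congr (toC _); apply: eq_bigr => i _; rewrite !mxE mulrC.
have ScE : Sc = invmx P *m diag_mx X *m P.
  by apply/orthomx_spectralP/normalmxP; rewrite ScH.
have DE : diag_mx X = P *m Sc *m invmx P.
  by rewrite ScE !mulmxA mulmxV // mul1mx mulmxK.
have X_ge0 i : 0 <= X 0 i.
  have -> : X 0 i = diag_mx X i i by rewrite mxE eqxx.
  rewrite DE PV /Sc /S map_mxM mulmxA -mulmxA.
  pose Y := map_mx toC A *m map_mx Num.conj P^T.
  have -> : P *m map_mx toC A^T = (map_mx Num.conj Y)^T.
    rewrite /Y map_mxM trmx_mul -map_mx_comp; congr (_ *m _).
      by apply/matrixP => a b; rewrite !mxE /= conjCK.
    by apply/matrixP => a b; rewrite !mxE /= toC_conj.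
  rewrite mxE sumr_ge0 // => l _; rewrite !mxE mulrC -normCK exprn_ge0 //.
pose l i := complex.Re (X 0 i).
have lE i : X 0 i = toC (l i).
  rewrite /l; move: (ger0_real (X_ge0 i)).
  by case: (X 0 i) => a b /complex_realP [c ->].
have diagE : diag_mx X = map_mx toC (diag_mx (\row_i l i)).
  by apply/matrixP => a b; rewrite !mxE lE; case: eqP => _;
  rewrite ?mulr1n ?mulr0n ?rmorph0.
have toCN : forall x, `|toC x| = toC `|x| by exact: normC_real.
have P1 j : minor_norm j P <= minor_bound d j.
  by apply: minor_norm_le => a b; exact: unitary_entry_le1.
have PV1 j : minor_norm j (invmx P) <= minor_bound d j.
  apply: minor_norm_le => a b; apply: unitary_entry_le1.
  by rewrite PV trmxC_unitary.
have mbC j : minor_bound d j = toC (minor_bound d j) by rewrite rmorph_nat.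
have conj_bound j (U V M : 'M[R[i]]_d) :
    minor_norm j U <= minor_bound d j -> minor_norm j V <= minor_bound d j ->
    minor_norm j (U *m M *m V) <= minor_bound d j ^+ 2 * minor_norm j M.
  move=> U1 V1; apply: le_trans (minor_norm_mul _ _ _) _.
  rewrite expr2 mulrAC; apply: ler_pM; rewrite ?minor_norm_ge0 //.
  apply: le_trans (minor_norm_mul _ _ _) _.
  by rewrite ler_wpM2r ?minor_norm_ge0.
have back j (M N : 'M[R]_d) :
    minor_norm j (map_mx toC M) <= minor_bound d j ^+ 2 * minor_norm j (map_mx toC N) ->
    minor_norm j M <= minor_bound d j ^+ 2 * minor_norm j N.
  rewrite !minor_norm_map // mbC -rmorphXn -rmorphM.
  by rewrite -lecR.
exists l; split.
- by move=> i; move: (X_ge0 i); rewrite lE -lecR.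
- apply: (map_poly_inj toC).
  rewrite map_char_poly -/Sc ScE char_poly_conj // diagE char_poly_trig; last first.
    by rewrite -diagE diag_mx_is_trig.
  rewrite rmorph_prod; apply: eq_bigr => i _.
  by rewrite rmorphB /= map_polyX map_polyC /= !mxE eqxx.
- by move=> j; apply: back; rewrite -diagE DE; exact: conj_bound.
- by move=> j; apply: back; rewrite -diagE -/S -/Sc {1}ScE; exact: conj_bound.
Qed.

Lemma perm_eigenvalues_mult (R : realType) (d : nat) (S : 'M[R]_d) (s : seq R) :
  char_poly S = \prod_(x <- s) ('X - x%:P) -> perm_eq (eigenvalues_mult S) s.
Proof.
move=> Sp; rewrite /eigenvalues_mult; set p := char_poly S in Sp *.
have p_neq0 : p != 0 by rewrite monic_neq0 // char_poly_monic.
apply/allP => x _ /=; apply/eqP.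
rewrite count_flatten -map_comp sumnE big_map /=.
under eq_bigr => y _ do rewrite count_nseq.
rewrite -mu_prod_XsubC -Sp.
have memE : root p x = (x \in rootsR p).
  by rewrite -(roots_on_rootsR p_neq0) itv_boundlr.
have [x_in|x_notin] := boolP (x \in rootsR p).
  rewrite (bigD1_seq x) ?uniq_roots //= eqxx mul1n big1 ?addn0 // => y.
  by move=> /negbTE ->.
rewrite big1_seq => [|y /andP[_ y_in]]; first by rewrite mupNroot // memE.
by rewrite /=; have [yx|//] := eqVneq y x; rewrite -yx y_in in x_notin.
Qed.

(** Among [j] distinct indices some [f i0] is at least [j - 1]; pair the
    corresponding factor with [a (j - 1)] and recurse. *)
Lemma prod_inj_le (R : realDomainType) (a : nat -> R) (d j : nat)
    (f : 'I_j -> 'I_d) :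
  (forall i, 0 <= a i) -> (forall i i', (i <= i' < d)%N -> a i' <= a i) ->
  injective f -> \prod_(i < j) a (f i) <= \prod_(i < j) a i.
Proof.
move=> a_ge0 a_decr; elim: j => [|j IHj] in f * => f_inj.
  by rewrite !big_ord0.
have [i0 ji0] : exists i0, (j <= f i0)%N.
  apply/existsP; rewrite -[X in is_true X]negbK negb_exists; apply/negP.
  move=> /forallP small.
  have lt_j i : (f i < j)%N by rewrite ltnNge small.
  have /leq_card : injective (fun i => Ordinal (lt_j i)).
    by move=> i i' /(congr1 val)/= /val_inj/f_inj.
  by rewrite !card_ord ltnn.
rewrite (bigD1_ord i0) //= big_ord_recr /= mulrC.
apply: ler_pM; rewrite ?a_ge0 ?prodr_ge0 //.
  by apply: IHj => i i' /f_inj /lift_inj.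
by apply: a_decr; rewrite ji0 ltn_ord.
Qed.

Section SingularValues.
Context {R : realType}.

Lemma singular_value_ge0 (d : nat) (A : 'M[R]_d) i : 0 <= singular_value A i.
Proof.
rewrite /singular_value; have [i_lt|?] := ltnP i (size (singular_values A)); last first.
  by rewrite nth_default.
have := mem_nth 0 i_lt; rewrite mem_sort => /mapP [x _ ->].
by rewrite sqrtr_ge0.
Qed.

(** Through [gram_diagonalization] both sides are compared with the minors of the
    diagonal matrix of the squared singular values; the largest of its minors is
    the product of the [j] largest entries. *)
Lemma singular_value_prod (d j : nat) : (j <= d)%N ->
  exists2 c : R, 0 < c & forall A : 'M[R]_d,
    \prod_(i < j) singular_value A i <= c * minor_norm j A /\
    minor_norm j A <= c * \prod_(i < j) singular_value A i.
Proof.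
move=> jd; have [c0 c0_gt0 gramP] := minor_norm_gram R d j.
set b : R := minor_bound d j.
have b_ge0 : 0 <= b by rewrite /b /minor_bound.
exists (b + Num.sqrt (c0 * (b ^+ 2 * b)) + 1).
  by rewrite ltr_wpDl // addr_ge0 // sqrtr_ge0.
move=> A; have [l [l_ge0 charE DleS SleD]] := gram_diagonalization A.
pose t := [tuple Num.sqrt (l i) | i < d].
have /tuple_permP [p sE] : perm_eq (singular_values A) t.
  rewrite /singular_values perm_sort.
  apply: (@perm_trans _ [seq Num.sqrt x | x <- [seq l i | i <- enum 'I_d]]).
    apply/perm_map/perm_eigenvalues_mult.
    by rewrite charE big_map -big_enum.
  by rewrite -map_comp.
have size_s : size (singular_values A) = d by rewrite sE size_map size_enum_ord.
have svE (i : 'I_d) : singular_value A i = Num.sqrt (l (p i)).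
  rewrite /singular_value sE (nth_map i) ?size_enum_ord //.
  by rewrite nth_ord_enum !tnth_map !tnth_ord_tuple.
have lE (i : 'I_d) : l (p i) = singular_value A i ^+ 2.
  by rewrite svE sqr_sqrtr.
have sv_decr i i' : (i <= i' < d)%N -> singular_value A i' <= singular_value A i.
  move=> /andP[ii' i'd].
  have := sort_sorted (@ge_total _ R)
    [seq Num.sqrt x | x <- eigenvalues_mult (A^T *m A)].
  move=> /(sorted_leq_nth ge_trans ge_refl 0); apply => //.
    by rewrite inE size_s (leq_ltn_trans ii').
  by rewrite inE size_s.
set D := diag_mx (\row_i l i) in DleS SleD.
have prodE : \prod_(i < j) singular_value A i ^+ 2 =
    (\prod_(i < j) singular_value A i) ^+ 2 by rewrite prodrXl.
have prod_ge0 : 0 <= \prod_(i < j) singular_value A i.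
  by rewrite prodr_ge0 // => i _; exact: singular_value_ge0.
have DleP : minor_norm j D <= b * (\prod_(i < j) singular_value A i) ^+ 2.
  rewrite /b /minor_bound natrM natrM -!mulrA [X in _ <= X]mulr_natl -sumr_const.
  apply: ler_sum => f _; rewrite mulr_natl -sumr_const; apply: ler_sum => g _.
  have -> : mxsub f g D = diag_mx (\row_i l (f i)) *m mxsub f g 1%:M.
    rewrite mul_diag_mx; apply/matrixP => i i'; rewrite !mxE.
    by case: eqP => _; rewrite ?mulr1 ?mulr0 ?mulr1n.
  rewrite det_mulmx det_diag normrM [X in _ <= X]mulrC.
  have det1_le : `|\det (mxsub f g (1%:M : 'M[R]_d))| <= j`!%:R.
    by apply: ler_det_fact => i i'; rewrite !mxE; case: eqP; rewrite ?normr1 ?normr0.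
  have [/injectiveP f_inj|/injectivePn [i [i' neq_ii' fii']]] := boolP (injectiveb f).
    apply: ler_pM => //.
    rewrite ger0_norm; last by rewrite prodr_ge0 // => i _; rewrite mxE.
    rewrite -prodE.
    have -> : \prod_i (\row_i0 l (f i0)) 0 i =
        \prod_(i < j) singular_value A ((p^-1)%g (f i)) ^+ 2.
      by apply: eq_bigr => i _; rewrite mxE -lE permKV.
    apply: (@prod_inj_le _ (fun i => singular_value A i ^+ 2) d j
              (fun i => (p^-1)%g (f i))).
    - by move=> i; exact: sqr_ge0.
    - by move=> i i' /sv_decr; rewrite ler_pXn2r // nnegrE singular_value_ge0.
    - by move=> i i' /perm_inj /f_inj.
  have -> : \det (mxsub f g (1%:M : 'M[R]_d)) = 0.
    apply: (@determinant_alternate _ _ _ i i' neq_ii') => h.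
    by rewrite !mxE fii'.
  by rewrite normr0 mulr0 mulr_ge0 // exprn_ge0.
have PleD : (\prod_(i < j) singular_value A i) ^+ 2 <= minor_norm j D.
  rewrite -prodE; pose f (i : 'I_j) := p (widen_ord jd i).
  apply: le_trans (minor_le_minor_norm D f f).
  have -> : mxsub f f D = diag_mx (\row_i l (f i)).
    apply/matrixP => i i'; rewrite !mxE (inj_eq perm_inj).
    by rewrite -!val_eqE.
  rewrite det_diag; apply: le_trans (ler_norm _).
  rewrite le_eqVlt; apply/orP; left; apply/eqP.
  by apply: eq_bigr => i _; rewrite mxE lE.
split.
  apply: (@le_trans _ _ (b * minor_norm j A)); last first.
    rewrite ler_wpM2r ?minor_norm_ge0 // -addrA lerDl.
    by rewrite addr_ge0 // sqrtr_ge0.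
  rewrite -(@ler_pXn2r _ 2) ?nnegrE ?mulr_ge0 ?minor_norm_ge0 //.
  apply: le_trans PleD _; apply: le_trans (DleS j) _.
  rewrite exprMn -/b ler_wpM2l ?exprn_ge0 //.
  by apply: le_trans (minor_norm_mul _ _ _) _; rewrite minor_norm_tr expr2.
apply: (@le_trans _ _ (Num.sqrt (c0 * (b ^+ 2 * b)) *
    \prod_(i < j) singular_value A i)).
  rewrite -(@ler_pXn2r _ 2) ?nnegrE ?mulr_ge0 ?minor_norm_ge0 ?sqrtr_ge0 //.
  rewrite exprMn sqr_sqrtr ?mulr_ge0 ?exprn_ge0 ?(ltW c0_gt0) //.
  apply: le_trans (gramP A) _.
  rewrite -(mulrA c0) -(mulrA (b ^+ 2)) ler_wpM2l ?(ltW c0_gt0) //.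
  by apply: le_trans (SleD j) _; rewrite -/b ler_wpM2l ?exprn_ge0.
by rewrite ler_wpM2r // -addrA addrCA lerDl addr_ge0.
Qed.

End SingularValues.

Section SingularValueFunction.
Context {R : realType}.
Implicit Types s a b : R.

(** For [j' = j.+1], [a = 1 - t] and [b = t] this is the singular value function
    of parameter [j + t] up to a constant factor, in a form that is visibly
    submultiplicative. *)
Definition minor_svf (d j j' : nat) (a b : R) (A : 'M[R]_d) : R :=
  minor_norm j A `^ a * minor_norm j' A `^ b.

Lemma minor_svf_ge0 (d j j' : nat) a b (A : 'M[R]_d) :
  0 <= minor_svf j j' a b A.
Proof. by rewrite mulr_ge0 ?powR_ge0. Qed.

Lemma minor_svf_mul (d j j' : nat) a b (A B : 'M[R]_d) : 0 <= a -> 0 <= b ->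
  minor_svf j j' a b (A *m B) <= minor_svf j j' a b A * minor_svf j j' a b B.
Proof.
move=> a0 b0; rewrite /minor_svf mulrACA -!powRM ?minor_norm_ge0 //.
by apply: ler_pM; rewrite ?powR_ge0 // ge0_ler_powR ?nnegrE ?mulr_ge0
  ?minor_norm_ge0 ?minor_norm_mul.
Qed.

Lemma ler_powR_prod (x y u v c c' a b : R) : 0 <= a -> 0 <= b ->
  0 <= x -> 0 <= y -> 0 <= u -> 0 <= v -> 0 <= c -> 0 <= c' ->
  x <= c * u -> y <= c' * v ->
  x `^ a * y `^ b <= c `^ a * c' `^ b * (u `^ a * v `^ b).
Proof.
move=> a0 b0 x0 y0 u0 v0 c0 c'0 xu yv; rewrite mulrACA -!powRM //.
by apply: ler_pM; rewrite ?powR_ge0 // ge0_ler_powR ?nnegrE ?mulr_ge0.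
Qed.

(** With [j] the integral part of [s] and [t = s - j], write
    [p_j * alpha^t = p_j^(1 - t) * p_(j + 1)^t], where [p_j] is the product of
    the [j] largest singular values and [alpha] is the next one. The case [s = k]
    is separate: it must not involve minors of order [k + 1], which vanish on
    [k]-dimensional spaces. *)
Lemma svf_minor_svf (d k : nat) s : 0 <= s <= k%:R -> (k < d)%N ->
  exists j j' : nat, exists a b c : R,
  [/\ (j <= k)%N /\ (j' <= k)%N, 0 <= a /\ 0 <= b, 0 < c &
      forall A : 'M[R]_d,
        svf s A <= c * minor_svf j j' a b A /\
        minor_svf j j' a b A <= c * svf s A].
Proof.
move=> /andP[s_ge0 s_le] kd; set j := Num.truncn s.
have /andP[j_le lt_j] : j%:R <= s < j.+1%:R by exact: truncn_itv.
have sd : s < d%:R by apply: le_lt_trans s_le _; rewrite ltr_nat.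
have p_ge0 i (A : 'M[R]_d) : 0 <= \prod_(i' < i) singular_value A i'.
  by rewrite prodr_ge0 // => i' _; exact: singular_value_ge0.
have [s_lt|s_ge] := ltP s k%:R; last first.
  have sk : s = k%:R by apply/le_anti; rewrite s_le.
  have [c c_gt0 cP] := @singular_value_prod R d k (ltnW kd).
  exists k, 0%N, 1, 0, c; split=> // A; have := cP A.
  rewrite /svf sd /= sk natrK subrr powRr0 mulr1.
  by rewrite /minor_svf powRr0 powRr1 ?minor_norm_ge0 // mulr1.
have jk : (j < k)%N by rewrite -(ltr_nat R); exact: le_lt_trans s_lt.
have [c c_gt0 cP] := @singular_value_prod R d j (ltnW (ltn_trans jk kd)).
have [c' c'_gt0 c'P] := @singular_value_prod R d j.+1 (leq_trans jk (ltnW kd)).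
set t := s - j%:R.
have t_ge0 : 0 <= t by rewrite subr_ge0.
have t_lt1 : t < 1 by rewrite ltrBlDl natr1.
exists j, j.+1, (1 - t), t, (c `^ (1 - t) * c' `^ t).
have t'_ge0 : 0 <= 1 - t by rewrite subr_ge0 ltW.
split; [by rewrite (ltnW jk) | by [] | by rewrite mulr_gt0 ?powR_gt0 | move=> A].
have svfE : svf s A = (\prod_(i < j) singular_value A i) `^ (1 - t) *
                      (\prod_(i < j.+1) singular_value A i) `^ t.
  rewrite /svf sd /= -/j -/t big_ord_recr /=.
  have sv_ge0 : 0 <= singular_value A j := singular_value_ge0 A j.
  rewrite powRM ?p_ge0 // mulrA -powRD subrK ?powRr1 ?p_ge0 //.
  by rewrite oner_eq0.
have [pN Np] := cP A; have [pN' Np'] := c'P A.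
by rewrite svfE; split; apply: ler_powR_prod => //;
  rewrite ?p_ge0 ?minor_norm_ge0 ?(ltW c_gt0) ?(ltW c'_gt0).
Qed.

Lemma svf_eq0 (d k : nat) s (A : 'M[R]_d) :
  k%:R < s -> (k < d)%N -> (\rank A <= k)%N -> svf s A = 0.
Proof.
move=> ks kd rA; rewrite /svf; have [sd|ds] := ltP s d%:R; last first.
  have -> : \det A = 0.
    apply/eqP; apply: contraTT rA => det_neq0; rewrite -ltnNge mxrank_unit //.
    by rewrite unitmxE unitfE.
  rewrite normr0 powR0 // mulf_neq0 ?gt_eqF //.
    by apply: le_lt_trans ks; rewrite ler0n.
  by rewrite invr_gt0 ltr0n (leq_ltn_trans _ kd).
set j := Num.truncn s.
have s_ge0 : 0 <= s by apply: ltW; apply: le_lt_trans ks; rewrite ler0n.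
have /andP[j_le lt_j] : j%:R <= s < j.+1%:R by exact: truncn_itv.
have kj : (k <= j)%N by rewrite -ltnS -(ltr_nat R); exact: lt_trans ks lt_j.
have [c _ cP] := @singular_value_prod R d k.+1 kd.
have [+ _] := cP A; rewrite minor_norm_eq0 ?ltnS // mulr0 => p_le0.
have /eqP : \prod_(i < k.+1) singular_value A i = 0.
  apply/le_anti; rewrite p_le0 prodr_ge0 // => i _; exact: singular_value_ge0.
rewrite prodf_seq_eq0 => /hasP [i _ /= /eqP sv0].
have [ij|ji] := ltnP i j.
  by rewrite (bigD1 (Ordinal ij)) //= sv0 !mul0r.
have ik : (i <= k)%N by rewrite -ltnS.
have ijE : nat_of_ord i = j by apply/eqP; rewrite eqn_leq ji (leq_trans ik).
have kjE : k = j by apply/eqP; rewrite eqn_leq kj -ijE.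
by rewrite -ijE sv0 powR0 ?mulr0 // subr_eq0 ijE -kjE gt_eqF.
Qed.

End SingularValueFunction.

(** * Orthogonal projections *)

Lemma eq_mulmx_cV (R : realType) (m n : nat) (A B : 'M[R]_(m, n)) :
  (forall x : 'cV[R]_n, A *m x = B *m x) -> A = B.
Proof.
move=> AB; apply/matrixP => i l; have /matrixP/(_ i 0) := AB (delta_mx l 0).
by rewrite -!colE !mxE.
Qed.

Section OrthoProj.
Context {R : realType} {d : nat}.
Implicit Types (W : {vspace 'cV[R]_d}) (A : 'M[R]_d) (x y w : 'cV[R]_d).

Lemma linfun_mulmx (n : nat) (A : 'M[R]_(n, d)) x :
  linfun (mulmx A : 'cV[R]_d -> 'cV[R]_n) x = A *m x.
Proof. by rewrite lfunE. Qed.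

Lemma dim_cV (n : nat) : dim 'cV[R]_n = n.
Proof. by rewrite dim_matrix; exact: muln1. Qed.

Lemma dot_eq0 x : x^T *m x = 0 -> x = 0.
Proof.
move=> /matrixP /(_ 0 0); rewrite !mxE => /eqP.
rewrite psumr_eq0 => [/allP xx0|i _]; last by rewrite mxE -expr2 sqr_ge0.
apply/matrixP => i o; rewrite ord1 mxE; apply/eqP.
by have := xx0 i (mem_index_enum i); rewrite mxE mulf_eq0 orbb.
Qed.

Lemma memv_bigcap_seq (I : Type) (r : seq I) (U : I -> {vspace 'cV[R]_d}) x :
  (x \in \bigcap_(i <- r) U i)%VS = all (fun i => x \in U i) r.
Proof.
by elim: r => [|i r IHr]; rewrite ?big_nil ?memvf // big_cons memv_cap IHr.
Qed.

Lemma ortho_complP W x :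
  reflect (forall w, w \in W -> w^T *m x = 0) (x \in ortho_compl W).
Proof.
rewrite /ortho_compl memv_bigcap_seq.
apply: (iffP allP) => [x_orth w wW|x_orth w wW]; last first.
  by rewrite memv_ker linfun_mulmx; apply/eqP/x_orth/vbasis_mem.
rewrite (coord_vbasis wW) raddf_sum mulmx_suml big1 // => i _ /=.
rewrite linearZ -scalemxAl.
have := x_orth (vbasis W)`_i; rewrite mem_nth ?size_tuple // => /(_ isT).
by rewrite memv_ker linfun_mulmx => /eqP ->; rewrite scaler0.
Qed.

Lemma cap_ortho_compl W : (W :&: ortho_compl W = 0)%VS.
Proof.
apply/eqP; rewrite -subv0; apply/subvP => x.
rewrite memv_cap memv0 => /andP[xW /ortho_complP /(_ _ xW) /dot_eq0 ->].
by rewrite eqxx.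
Qed.

(** Each of the [\dim W] equations defining the complement lowers the dimension
    by at most one. *)
Lemma add_ortho_compl W : (W + ortho_compl W = fullv)%VS.
Proof.
have dim_bound (s : seq 'cV[R]_d) :
    (d <= size s + \dim (\bigcap_(w <- s)
        lker (linfun (mulmx w^T : 'cV[R]_d -> 'M[R]_(1, 1))))%VS)%N.
  elim: s => [|w s IHs].
    by rewrite big_nil dimvf dim_cV.
  rewrite big_cons capvC; set U := (X in (X :&: _)%VS).
  have := limg_ker_dim (linfun (mulmx w^T : 'cV[R]_d -> 'M[R]_(1, 1))) U.
  set f := linfun _; set kd := \dim (_ :&: _) => kerE.
  have : (\dim (f @: U) <= 1)%N.
    by apply: leq_trans (dimvS (subvf _)) _; rewrite dimvf dim_cV.
  move=> im_le; apply: leq_trans IHs _.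
  by rewrite -/U -kerE addSnnS leq_add2l -[X in (_ <= X)%N]addn1 leq_add2l.
apply/eqP; rewrite eqEdim subvf /=.
rewrite dimv_disjoint_sum ?cap_ortho_compl // dimvf dim_cV.
by have := dim_bound (vbasis W); rewrite size_tuple.
Qed.

Lemma ortho_projE W x : ortho_proj W *m x = daddv_pi W (ortho_compl W) x.
Proof.
have {2}-> : x = \sum_i x i 0 *: delta_mx i 0.
  by rewrite {1}[x]matrix_sum_delta; apply: eq_bigr => i _; rewrite big_ord1.
rewrite linear_sum; apply/matrixP => i o; rewrite ord1 mxE summxE.
by apply: eq_bigr => l _; rewrite linearZ !mxE mulrC.
Qed.

Lemma ortho_proj_mem W x : ortho_proj W *m x \in W.
Proof. by rewrite ortho_projE memv_pi. Qed.

Lemma ortho_proj_id W x : x \in W -> ortho_proj W *m x = x.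
Proof. by move=> xW; rewrite ortho_projE daddv_pi_id ?cap_ortho_compl. Qed.

Lemma ortho_proj_orth W x w : w \in W -> w^T *m (x - ortho_proj W *m x) = 0.
Proof.
move=> wW; have := @daddv_pi_add _ _ _ _ x (cap_ortho_compl W).
rewrite add_ortho_compl memvf -ortho_projE => /(_ isT) {1}<-.
rewrite addrC addKr.
suff /ortho_complP : daddv_pi (ortho_compl W) W x \in ortho_compl W by apply.
exact: memv_pi.
Qed.

Lemma ortho_proj_idem W : ortho_proj W *m ortho_proj W = ortho_proj W.
Proof.
by apply: eq_mulmx_cV => x; rewrite -mulmxA ortho_proj_id ?ortho_proj_mem.
Qed.

(** [P^T (x - P x)] is orthogonal to itself, hence [P^T = P^T P]. *)
Lemma ortho_proj_sym W : (ortho_proj W)^T = ortho_proj W.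
Proof.
set P := ortho_proj W.
have PTP : P^T *m P = P^T.
  apply/esym/eqP; rewrite -subr_eq0 -[X in X - _]mulmx1 -mulmxBr; apply/eqP.
  apply: eq_mulmx_cV => x; rewrite mul0mx -mulmxA mulmxBl mul1mx.
  set z := x - P *m x; apply: dot_eq0.
  by rewrite {2}/z mulmxA -trmx_mul ortho_proj_orth ?ortho_proj_mem.
by rewrite -PTP -[LHS]trmxK trmx_mul trmxK PTP trmxK.
Qed.

(** [P^T P = P] makes the diagonal entry [P l l] the squared norm of column [l]. *)
Lemma ortho_proj_entry W i l : `|ortho_proj W i l| <= 1.
Proof.
set P := ortho_proj W.
have symE b c : P b c = P c b by rewrite /P -{1}ortho_proj_sym mxE.
have sumE a : \sum_i P i a ^+ 2 = P a a.
  have /matrixP/(_ a a) := ortho_proj_idem W; rewrite mxE => <-.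
  by apply: eq_bigr => b _; rewrite expr2 {1}symE.
have le_diag b a : P b a ^+ 2 <= P a a.
  by rewrite -sumE (bigD1 b) //= lerDl sumr_ge0 // => c _; exact: sqr_ge0.
have Pll := le_diag l l; have Pil := le_diag i l.
have Pll1 : P l l <= 1 by nra.
by rewrite -(@expr_le1 _ 2) // real_normK ?num_real //; exact: le_trans Pil _.
Qed.

Lemma rank_ortho_proj W : \rank (ortho_proj W) = \dim W.
Proof.
pose B : 'M[R]_(d, \dim W) := \matrix_(i, l) (vbasis W)`_l i 0.
have B_sum (c : 'cV[R]_(\dim W)) : B *m c = \sum_l c l 0 *: (vbasis W)`_l.
  apply/matrixP => i o; rewrite ord1 mxE summxE.
  by apply: eq_bigr => l _; rewrite !mxE mulrC.
have PB : ortho_proj W *m B = B.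
  apply: eq_mulmx_cV => c; rewrite -mulmxA ortho_proj_id // B_sum.
  by apply: memv_suml => l _; rewrite memvZ // vbasis_mem // mem_nth ?size_tuple.
have rB : \rank B = \dim W.
  rewrite -mxrank_tr; apply/eqP; apply: inj_row_free => v vB.
  have Bv : B *m v^T = 0 by rewrite -[B]trmxK -trmx_mul vB trmx0.
  have /freeP free_b := basis_free (vbasisP W).
  apply/matrixP => o l; rewrite ord1 [RHS]mxE.
  have := free_b (v 0); apply; rewrite -[RHS]Bv B_sum.
  by apply: eq_bigr => l' _; rewrite mxE.
pose C : 'M[R]_(\dim W, d) := \matrix_(i, l) coord (vbasis W) i (col l (ortho_proj W)).
have PE : ortho_proj W = B *m C.
  apply/matrixP => i l; have := ortho_proj_mem W (delta_mx l 0).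
  rewrite -colE => /coord_vbasis /matrixP /(_ i 0); rewrite mxE => ->.
  by rewrite summxE [RHS]mxE; apply: eq_bigr => a _; rewrite !mxE mulrC.
apply/eqP; rewrite eqn_leq -{2}rB -PB mxrankM_maxl andbT PE.
by apply: leq_trans (mxrankM_maxl _ _) _; rewrite rB.
Qed.

Lemma mem_mx_image A W x : x \in W -> A *m x \in mx_image A W.
Proof. by move=> xW; rewrite -linfun_mulmx memv_img. Qed.

Lemma mx_imageM A B W : mx_image A (mx_image B W) = mx_image (A *m B) W.
Proof.
rewrite /mx_image -limg_comp; congr (_ @: _)%VS; apply/lfunP => x.
by rewrite comp_lfunE !linfun_mulmx mulmxA.
Qed.

Lemma mx_image1 W : mx_image 1%:M W = W.
Proof.
apply/vspaceP => x; apply/idP/idP.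
  by move=> /memv_imgP [y yW ->]; rewrite linfun_mulmx mul1mx.
by move=> /(mem_mx_image 1%:M); rewrite mul1mx.
Qed.

Lemma dim_mx_image A W : A \in unitmx -> \dim (mx_image A W) = \dim W.
Proof.
move=> Au; apply: limg_dim_eq; apply/eqP; rewrite -subv0; apply/subvP => x.
rewrite memv_cap memv0 memv_ker linfun_mulmx => /andP[_ /eqP Ax0].
by rewrite -(mulKmx Au x) Ax0 mulmx0.
Qed.

Lemma ortho_proj_image A W :
  ortho_proj (mx_image A W) *m (A *m ortho_proj W) = A *m ortho_proj W.
Proof.
apply: eq_mulmx_cV => x; rewrite -!mulmxA ortho_proj_id //.
by rewrite mem_mx_image ?ortho_proj_mem.
Qed.

(** The inverse of [A] carries the image back into [W], where the projection is
    the identity. For a fixed [A] the right factor is a constant when the product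
    is multiplied further on the left. *)
Lemma ortho_proj_image_factor A W : A \in unitmx ->
  A *m ortho_proj W *m (invmx A *m ortho_proj (mx_image A W)) =
  ortho_proj (mx_image A W).
Proof.
move=> Au; apply: eq_mulmx_cV => x; rewrite -!mulmxA.
have /memv_imgP [y yW yE] := ortho_proj_mem (mx_image A W) x.
by rewrite yE linfun_mulmx mulKmx // ortho_proj_id.
Qed.

End OrthoProj.

(** * Finite domination *)

Section Separable.
Context {R : realType} {I X : Type}.
Implicit Types (h : I -> X -> R).

(** Functions of finite rank in the two variables, with bounded coefficients in
    the first one; polynomials in the entries of a bounded matrix [P i] and an
    arbitrary matrix are of this form. *)
Definition separable h := exists (J : finType) (B : R) (u : I -> J -> R)
    (v : X -> J -> R),
  (forall i l, `|u i l| <= B) /\ (forall i x, h i x = \sum_l u i l * v x l).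

Lemma eq_separable h h' : h =2 h' -> separable h -> separable h'.
Proof.
move=> hh' [J [B [u [v [uB hE]]]]]; exists J, B, u, v; split=> // i x.
by rewrite -hh' hE.
Qed.

Lemma separable_r (v : X -> R) : separable (fun _ x => v x).
Proof.
exists unit, 1, (fun _ _ => 1), (fun x _ => v x); split=> [i l|i x].
  by rewrite normr1.
by rewrite big_const card_unit /= mul1r addr0.
Qed.

Lemma separable_l (u : I -> R) (B : R) : (forall i, `|u i| <= B) ->
  separable (fun i _ => u i).
Proof.
move=> uB; exists unit, B, (fun i _ => u i), (fun _ _ => 1); split=> // i x.
by rewrite big_const card_unit /= mulr1 addr0.
Qed.

Lemma separableD h h' : separable h -> separable h' ->
  separable (fun i x => h i x + h' i x).
Proof.
move=> [J [B [u [v [uB hE]]]]] [J' [B' [u' [v' [uB' hE']]]]].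
exists (J + J')%type, (Num.max B B'),
  (fun i l => match l with inl a => u i a | inr b => u' i b end),
  (fun x l => match l with inl a => v x a | inr b => v' x b end).
split=> [i [a|b]|i x]; rewrite ?le_max ?uB ?uB' ?orbT //.
by rewrite big_sumType hE hE'.
Qed.

Lemma separableM h h' : separable h -> separable h' ->
  separable (fun i x => h i x * h' i x).
Proof.
move=> [J [B [u [v [uB hE]]]]] [J' [B' [u' [v' [uB' hE']]]]].
exists (J * J')%type, (B * B'), (fun i l => u i l.1 * u' i l.2),
  (fun x l => v x l.1 * v' x l.2).
split=> [i [a b]|i x]; first by rewrite normrM ler_pM.
rewrite hE hE' big_distrlr /= pair_bigA /=.
by apply: eq_bigr => -[a b] _; rewrite mulrACA.
Qed.

Lemma separable_sum (T : Type) (r : seq T) (h : T -> I -> X -> R) :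
  (forall t, separable (h t)) -> separable (fun i x => \sum_(t <- r) h t i x).
Proof.
move=> h_sep; elim: r => [|t r IHr].
  by apply: eq_separable (separable_r (fun=> 0)) => i x; rewrite big_nil.
by apply: eq_separable (separableD (h_sep t) IHr) => i x; rewrite big_cons.
Qed.

Lemma separable_prod (T : Type) (r : seq T) (h : T -> I -> X -> R) :
  (forall t, separable (h t)) -> separable (fun i x => \prod_(t <- r) h t i x).
Proof.
move=> h_sep; elim: r => [|t r IHr].
  by apply: eq_separable (separable_r (fun=> 1)) => i x; rewrite big_nil.
by apply: eq_separable (separableM (h_sep t) IHr) => i x; rewrite big_cons.
Qed.

Lemma separableX h n : separable h -> separable (fun i x => h i x ^+ n).
Proof.
move=> h_sep; elim: n => [|n IHn].
  by apply: eq_separable (separable_r (fun=> 1)) => i x; rewrite expr0.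
by apply: eq_separable (separableM h_sep IHn) => i x; rewrite exprS.
Qed.

Lemma separable_det n (M : I -> X -> 'M[R]_n) :
  (forall a b, separable (fun i x => M i x a b)) ->
  separable (fun i x => \det (M i x)).
Proof.
move=> M_sep; rewrite /determinant; apply: separable_sum => s.
apply: separableM; first exact: (separable_r (fun=> (-1) ^+ s)).
by apply: separable_prod => a; exact: M_sep.
Qed.

(** The coefficient vectors [u i] span a finite-dimensional space. Finitely many
    of them span it already, and the coordinates of the others with respect to
    these are bounded because the [u i] are. *)
Lemma separable_dominated_sum h : separable h ->
  exists C : R, exists s : seq I, 0 <= C /\
    forall i x, `|h i x| <= C * \sum_(k <- s) `|h k x|.
Proof.
move=> [J [B [u [v [uB hE]]]]].
pose U i : 'rV[R]_#|J| := \row_l u i (enum_val l).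
pose V (s : seq I) := <<[seq U k | k <- s]>>%VS.
have ex_dim : exists r, `[< exists s, r = \dim (V s) >].
  by exists (\dim (V [::])); apply/asboolP; exists [::].
have dim_le r : `[< exists s, r = \dim (V s) >] -> (r <= #|J|)%N.
  move=> /asboolP [s ->]; apply: leq_trans (dimvS (subvf _)) _.
  by rewrite dimvf dim_matrix; apply: eq_leq; exact: mul1n.
(* A list whose span has the largest dimension spans all the [U i]. *)
case: (ex_maxnP ex_dim dim_le) => r /asboolP [s ->] s_max.
have U_span i : U i \in V s.
  have sub : (V s <= V (i :: s))%VS.
    by apply: sub_span => w ws; rewrite inE ws orbT.
  have /eqP -> : V s == V (i :: s).
    by rewrite eqEdim sub s_max //; apply/asboolP; exists (i :: s).
  by rewrite memv_span // inE eqxx.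
pose W := in_tuple [seq U k | k <- s].
pose c a := \sum_l `|B| * `|coord W a (delta_mx 0 l)|.
have coord_le i a : `|coord W a (U i)| <= c a.
  rewrite [U i]matrix_sum_delta big_ord1 linear_sum.
  apply: le_trans (ler_norm_sum _ _ _) _; apply: ler_sum => l _.
  rewrite linearZ normrM ler_wpM2r // mxE.
  by apply: le_trans (uB i _) _; exact: ler_norm.
exists (\sum_a c a), s; split.
  by rewrite sumr_ge0 // => a _; rewrite sumr_ge0 // => l _; rewrite mulr_ge0.
move=> i x.
pose vx : 'cV[R]_#|J| := \col_l v x (enum_val l).
have hU k : h k x = (U k *m vx) 0 0.
  rewrite hE mxE (reindex (@enum_val _ predT)) /=; last first.
    by apply: onW_bij; exact: enum_val_bij.
  by apply: eq_bigr => l _; rewrite !mxE.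
rewrite hU (coord_span (U_span i : U i \in <<W>>%VS)) mulmx_suml summxE.
apply: le_trans (ler_norm_sum _ _ _) _; rewrite mulr_suml.
apply: ler_sum => a _; rewrite -scalemxAl mxE normrM.
apply: ler_pM => //.
have a_lt : (a < size s)%N by rewrite -(size_map U) ltn_ord.
rewrite (nth_map i) // -hU (big_nth i) big_mkord (bigD1 (Ordinal a_lt)) //=.
by rewrite lerDl sumr_ge0.
Qed.

(** A sum over [s] is at most [size s] times its largest term. *)
Lemma separable_dominated h : separable h ->
  exists C : R, exists s : seq I, 0 < C /\    forall i x, 0 < `|h i x| ->
      exists2 a, (a < size s)%N & `|h i x| <= C * `|h (nth i s a) x|.
Proof.
move=> /separable_dominated_sum [C [s [C_ge0 hC]]].
pose C' := C * (size s)%:R + 1.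
have C'_gt0 : 0 < C' by rewrite ltr_wpDl // mulr_ge0.
exists C', s; split=> // i x h_gt0.
have [[a a_lt ha]|no_a] := pselect
    (exists2 a, (a < size s)%N & `|h i x| <= C' * `|h (nth i s a) x|).
  by exists a.
have small a : (a < size s)%N -> `|h (nth i s a) x| <= `|h i x| / C'.
  move=> a_lt; rewrite ler_pdivlMr // mulrC leNgt; apply/negP => /ltW ha.
  by apply: no_a; exists a.
have sum_le : \sum_(k <- s) `|h k x| <= (size s)%:R * (`|h i x| / C').
  rewrite (big_nth i) big_mkord mulr_natl -[X in _ *+ X]card_ord -sumr_const.
  by apply: ler_sum => a _; apply: small.
have : `|h i x| < `|h i x|; last by rewrite ltxx.
apply: le_lt_trans (hC i x) _.
apply: le_lt_trans (ler_wpM2l C_ge0 sum_le) _.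
rewrite !mulrA ltr_pdivrMr // [X in _ < X]mulrC ltr_pM2r //.
by rewrite ltrDl.
Qed.

End Separable.

Section MinorDomination.
Context {R : realType} {d : nat}.

(** Comparable with [minor_norm j A ^+ 2], but a polynomial in the entries. *)
Definition minor_sq (j : nat) (A : 'M[R]_d) : R :=
  \sum_(f : {ffun 'I_j -> 'I_d}) \sum_(g : {ffun 'I_j -> 'I_d})
    \det (mxsub f g A) ^+ 2.

Lemma minor_sq_ge0 j A : 0 <= minor_sq j A.
Proof. by rewrite sumr_ge0 // => f _; rewrite sumr_ge0 // => g _; exact: sqr_ge0. Qed.

Lemma minor_sq_le j A : minor_sq j A <= minor_norm j A ^+ 2.
Proof.
rewrite expr2 {1}/minor_norm mulr_suml; apply: ler_sum => f _.
rewrite mulr_suml; apply: ler_sum => g _.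
by rewrite -real_normK ?num_real // expr2 ler_wpM2l // minor_le_minor_norm.
Qed.

Lemma minor_norm_sq_le j : exists2 c : R, 0 < c &
  forall A, minor_norm j A ^+ 2 <= c * minor_sq j A.
Proof.
pose n : R := #|{ffun 'I_j -> 'I_d}|%:R * #|{ffun 'I_j -> 'I_d}|%:R.
have n_ge0 : 0 <= n by rewrite mulr_ge0.
exists (n ^+ 2 + 1) => [|A]; first by rewrite ltr_wpDl // exprn_ge0.
have le_sqrt : minor_norm j A <= n * Num.sqrt (minor_sq j A).
  rewrite /n -mulrA [X in _ <= X]mulr_natl -sumr_const; apply: ler_sum => f _.
  rewrite mulr_natl -sumr_const; apply: ler_sum => g _.
  rewrite -sqrtr_sqr ler_sqrt ?minor_sq_ge0 // /minor_sq (bigD1 f) //=.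
  rewrite (bigD1 g) //= -addrA lerDl addr_ge0 // sumr_ge0 // => f' _.
    exact: sqr_ge0.
  by rewrite sumr_ge0 // => g' _; exact: sqr_ge0.
apply: (@le_trans _ _ (n ^+ 2 * minor_sq j A)).
  rewrite -[X in _ * X]sqr_sqrtr ?minor_sq_ge0 // -exprMn.
  by rewrite ler_pXn2r // nnegrE ?mulr_ge0 ?sqrtr_ge0 ?minor_norm_ge0.
by rewrite ler_wpM2r ?minor_sq_ge0 // lerDl.
Qed.

Lemma minor_norm_dominated (I : Type) (P : I -> 'M[R]_d) (j j' p p' : nat) :
  (forall i a b, `|P i a b| <= 1) ->
  let G i A := minor_norm j (A *m P i) ^+ p * minor_norm j' (A *m P i) ^+ p' in
  exists C : R, exists s : seq I, 0 < C /\    forall i A, 0 < G i A ->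
      exists2 a, (a < size s)%N & G i A <= C * G (nth i s a) A.
Proof.
move=> P1 G.
pose h i A := minor_sq j (A *m P i) ^+ p * minor_sq j' (A *m P i) ^+ p'.
have entry_sep a b : separable (fun i (A : 'M[R]_d) => (A *m P i) a b).
  suff : separable (fun i (A : 'M[R]_d) => \sum_l A a l * P i l b).
    by apply: eq_separable => i A; rewrite mxE.
  apply: separable_sum => l.
  apply: (separableM (separable_r (fun A : 'M[R]_d => A a l))).
  by apply: separable_l => i; exact: P1.
have sq_sep n : separable (fun i A => minor_sq n (A *m P i)).
  apply: separable_sum => f; apply: separable_sum => g; apply: separableX.
  apply: separable_det => a b.
  by apply: eq_separable (entry_sep (f a) (g b)) => i A; rewrite [RHS]mxE.
have h_sep : separable h by apply: separableM; apply: separableX.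
have h_ge0 i A : 0 <= h i A by rewrite mulr_ge0 // exprn_ge0 ?minor_sq_ge0.
have G_ge0 i A : 0 <= G i A by rewrite mulr_ge0 // exprn_ge0 ?minor_norm_ge0.
have [c c_gt0 cP] := minor_norm_sq_le j.
have [c' c'_gt0 c'P] := minor_norm_sq_le j'.
have GE i A : G i A ^+ 2 =
    (minor_norm j (A *m P i) ^+ 2) ^+ p * (minor_norm j' (A *m P i) ^+ 2) ^+ p'.
  by rewrite /G exprMn -!exprM !(mulnC 2).
have hG i A : h i A <= G i A ^+ 2.
  rewrite GE; apply: ler_pM; rewrite ?exprn_ge0 ?minor_sq_ge0 //.
    by apply: lerXn2r; rewrite ?nnegrE ?exprn_ge0 ?minor_sq_ge0
      ?minor_norm_ge0 ?minor_sq_le.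
  by apply: lerXn2r; rewrite ?nnegrE ?exprn_ge0 ?minor_sq_ge0
      ?minor_norm_ge0 ?minor_sq_le.
pose e := c ^+ p * c' ^+ p'.
have e_gt0 : 0 < e by rewrite mulr_gt0 ?exprn_gt0.
have Gh i A : G i A ^+ 2 <= e * h i A.
  rewrite GE /e /h mulrACA -!exprMn.
  apply: ler_pM; rewrite ?exprn_ge0 ?minor_norm_ge0 //.
    by apply: lerXn2r; rewrite ?nnegrE ?mulr_ge0 ?(ltW c_gt0) ?exprn_ge0 ?minor_sq_ge0
      ?minor_norm_ge0.
  by apply: lerXn2r; rewrite ?nnegrE ?mulr_ge0 ?(ltW c'_gt0) ?exprn_ge0 ?minor_sq_ge0
    ?minor_norm_ge0.
have [C [s [C_gt0 sP]]] := separable_dominated h_sep.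
have eC_gt0 : 0 < e * C by rewrite mulr_gt0.
exists (e * C + 1), s; split=> [|i A G_gt0]; first by rewrite addr_gt0.
have h_gt0 : 0 < `|h i A|.
  rewrite ger0_norm // -(pmulr_rgt0 _ e_gt0).
  by apply: lt_le_trans (Gh i A); rewrite exprn_gt0.
have [a a_lt] := sP i A h_gt0; rewrite !ger0_norm // => ha.
exists a => //.
have [C1_ge0 Gk_ge0] : 0 <= e * C + 1 /\ 0 <= G (nth i s a) A.
  by split=> //; rewrite addr_ge0 // ltW.
rewrite -(@ler_pXn2r _ 2) ?nnegrE ?(mulr_ge0 C1_ge0) //.
apply: le_trans (Gh i A) _.
apply: le_trans (ler_wpM2l (ltW e_gt0) ha) _; rewrite mulrA exprMn.
apply: ler_pM; rewrite ?hG ?h_ge0 ?(ltW eC_gt0) //.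
by nra.
Qed.

End MinorDomination.

(** * Sums over words *)

Section WordSums.
Context {R : numDomainType} {m : nat}.
Implicit Types (g : seq 'I_m -> R) (n l : nat).

(** Defined by recursion, so that splitting a word into a prefix and a suffix
    needs no reindexing ([word_sum_cat]). *)
Fixpoint word_sum n g : R :=
  if n is n'.+1 then \sum_(i < m) word_sum n' (fun I => g (i :: I)) else g [::].

Lemma tuple_word_sum n g : \sum_(I : n.-tuple 'I_m) g I = word_sum n g.
Proof.
elim: n g => [|n IHn] g /=.
  rewrite (bigD1 [tuple]) //= big1 ?addr0 // => t.
  by move=> /negP[]; apply/eqP; exact: tuple0.
under [RHS]eq_bigr => i _ do rewrite -IHn.
rewrite pair_bigA /=.
rewrite (reindex (fun p : 'I_m * n.-tuple 'I_m => [tuple of p.1 :: p.2])) //.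
exists (fun t : n.+1.-tuple 'I_m => (thead t, [tuple of behead t])).
  by move=> [i t] _; rewrite theadE; congr (_, _); apply: val_inj.
by move=> t _; rewrite [RHS]tuple_eta.
Qed.

Lemma ler_word_sum n g g' : (forall I, size I = n -> g I <= g' I) ->
  word_sum n g <= word_sum n g'.
Proof.
elim: n g g' => [|n IHn] g g' gg' /=; first exact: gg'.
by apply: ler_sum => i _; apply: IHn => I In; apply: gg'; rewrite /= In.
Qed.

Lemma word_sum_ge0 n g : (forall I, 0 <= g I) -> 0 <= word_sum n g.
Proof.
elim: n g => [|n IHn] g g0 /=; first exact: g0.
by apply: sumr_ge0 => i _; exact: IHn.
Qed.

Lemma word_sum_cat n l g :
  word_sum (n + l) g = word_sum n (fun J => word_sum l (fun L => g (J ++ L))).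
Proof.
elim: n g => [|n IHn] g //=; apply: eq_bigr => i _; exact: IHn.
Qed.

Lemma word_sumZ n c g : word_sum n (fun I => c * g I) = c * word_sum n g.
Proof.
elim: n g => [|n IHn] g //=; rewrite mulr_sumr.
by apply: eq_bigr => i _; exact: IHn.
Qed.

Lemma word_sumZr n c g : word_sum n (fun I => g I * c) = word_sum n g * c.
Proof.
elim: n g => [|n IHn] g //=; rewrite mulr_suml.
by apply: eq_bigr => i _; exact: IHn.
Qed.

Lemma word_sum_cst n c : word_sum n (fun=> c) = c *+ (m ^ n).
Proof.
elim: n => [|n IHn] //=; rewrite IHn sumr_const card_ord -mulrnA.
by rewrite -expnSr.
Qed.

Lemma word_sum_sum (T : Type) (r : seq T) n (g : T -> seq 'I_m -> R) :
  word_sum n (fun I => \sum_(t <- r) g t I) = \sum_(t <- r) word_sum n (g t).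
Proof.
elim: n g => [|n IHn] g //=; rewrite exchange_big; apply: eq_bigr => i _.
exact: IHn.
Qed.

Lemma word_sum_prefix (K : seq 'I_m) n g : (forall I, 0 <= g I) ->
  word_sum n (fun I => g (K ++ I)) <= word_sum (size K + n) g.
Proof.
elim: K g => [|i K IHK] g g0 //=; rewrite (bigD1 i) //=.
apply: le_trans (IHK (fun I => g (i :: I)) (fun I => g0 _)) _.
by rewrite lerDl sumr_ge0 // => i' _; apply: word_sum_ge0.
Qed.

End WordSums.

(** * Subadditive sequences *)

Section Fekete.
Context {R : realType}.
Implicit Types (u f : nat -> R).

Lemma cvgn_up_to_inverse f (L : R) :
  (forall e, 0 < e -> exists A : R, forall n, (0 < n)%N ->
     `|f n - L| <= e + A / n%:R) ->
  f @ \oo --> L.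
Proof.
move=> fL; apply/cvgrPdist_le => e e_gt0.
have e2_gt0 : 0 < e / 2 by rewrite divr_gt0.
have [A fA] := fL _ e2_gt0.
exists (Num.bound (`|A| / (e / 2))).+1 => // n /= n_big.
have n_gt0 : (0 < n)%N by exact: leq_ltn_trans n_big.
have nR_gt0 : 0 < n%:R :> R by rewrite ltr0n.
rewrite distrC; apply: le_trans (fA n n_gt0) _.
rewrite [X in _ <= X](splitr e) lerD2l ler_pdivrMr // mulrC -ler_pdivrMr //.
have A_ge0 : 0 <= `|A| / (e / 2) by rewrite divr_ge0 // ltW.
apply: le_trans (ltW (le_lt_trans _ (archi_boundP A_ge0))) _.
  by rewrite ler_pM2r ?invr_gt0 // ler_norm.
by rewrite ler_nat ltnW.
Qed.

Lemma subadditive_mul u (q k r : nat) :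
  (forall n l, u (n + l)%N <= u n + u l) ->
  u (k * q + r)%N <= k%:R * u q + u r.
Proof.
move=> u_sub; elim: k => [|k IHk]; first by rewrite mul0n mul0r !add0r add0n.
rewrite mulSn -addnA; apply: le_trans (u_sub _ _) _.
by move: IHk; rewrite -natr1 mulrDl mul1r; lra.
Qed.

(** Fekete's lemma, with limit [inf_q (u q + c) / q]. The error is kept in the
    form [e + A / n] because sequences that differ from [u] by [C + e * n] then
    have the same limit. *)
Lemma fekete u (c B : R) :
  (forall n l, u (n + l)%N <= u n + u l + c) ->
  (forall n, - (B * n.+1%:R) <= u n) ->
  exists L : R, forall e, 0 < e -> exists A : R, forall n, (0 < n)%N ->
    `|n%:R^-1 * u n - L| <= e + A / n%:R.
Proof.
move=> u_sub u_ge; pose w n := u n + c.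
have w_sub n l : w (n + l)%N <= w n + w l.
  by rewrite /w; have := u_sub n l; lra.
pose S := [set w q / q%:R | q in [set q | (0 < q)%N]].
have S_lb : has_lbound S.
  exists (- (2 * `|B|) - `|c|) => _ [q /= q_gt0 <-].
  have qR : 1 <= q%:R :> R by rewrite ler1n.
  rewrite ler_pdivlMr; last by lra.
  have := u_ge q; rewrite -natr1 /w.
  have q1 : 0 <= q%:R - 1 :> R by rewrite subr_ge0.
  have q2 : 0 <= q%:R + 1 :> R by lra.
  have B0 : 0 <= `|B| - B by rewrite subr_ge0 ler_norm.
  have := mulr_ge0 B0 q2; have := mulr_ge0 (normr_ge0 B) q1.
  have := mulr_ge0 (normr_ge0 c) q1; have := ler_norm (- c); rewrite normrN.
  lra.
have S0 : S !=set0 by exists (w 1%N / 1%:R), 1%N.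
exists (inf S) => e e_gt0.
have [_ [q /= q_gt0 <-] wq] := inf_adherent e_gt0 (conj S0 S_lb).
have qR : 1 <= q%:R :> R by rewrite ler1n.
pose M := \sum_(r < q) `|w r|.
exists (M + `|w q| + `|c|) => n n_gt0.
have nR : 1 <= n%:R :> R by rewrite ler1n.
have low : inf S <= w n / n%:R by apply: ge_inf => //; exists n.
have wrM : w (n %% q)%N <= M.
  rewrite /M (bigD1 (Ordinal (ltn_pmod n q_gt0))) //=.
  by rewrite (le_trans (ler_norm _)) // lerDl sumr_ge0.
(* Split [n] into [n %/ q] blocks of length [q] and a remainder. *)
have up : w n <= (n %/ q)%:R * w q + M.
  rewrite {1}(divn_eq n q); apply: le_trans (subadditive_mul q _ _ w_sub) _.
  by rewrite lerD2l.
have kq : (n %/ q)%:R * q%:R = n%:R - (n %% q)%:R :> R.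
  by rewrite {2}(divn_eq n q) natrD natrM addrK.
have rq : (n %% q)%:R <= q%:R :> R by rewrite ler_nat ltnW ?ltn_pmod.
have r0 : 0 <= (n %% q)%:R :> R by [].
have up2 : w n <= n%:R * (inf S + e) + `|w q| + M.
  set k : R := (n %/ q)%:R in up kq; set r : R := (n %% q)%:R in kq rq r0.
  have wqE : w q = q%:R * (w q / q%:R) by rewrite mulrC divfK // gt_eqF //; lra.
  set x := w q / q%:R in wq wqE.
  have kE : k * w q = n%:R * x - r * x by rewrite wqE mulrA kq mulrBl.
  have rx : - (r * x) <= `|w q|.
    rewrite wqE normrM; have := ler_norm (- x); rewrite normrN.
    have : 0 <= `|x| by []. 
    rewrite (ger0_norm (_ : 0 <= q%:R)) //; nra.
  nra.
have -> : n%:R^-1 * u n = w n / n%:R - c / n%:R.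
  by rewrite /w -mulrBl addrK mulrC.
have n_inv : 0 < n%:R^-1 :> R by rewrite invr_gt0; lra.
have up3 : w n / n%:R <= inf S + e + (`|w q| + M) / n%:R.
  have n_gt0' : 0 < n%:R :> R by lra.
  by rewrite ler_pdivrMr // mulrDl divfK ?gt_eqF //; lra.
rewrite ler_norml; apply/andP.
have c1 : c / n%:R <= `|c| / n%:R by rewrite ler_pM2r // ler_norm.
have c2 : - (c / n%:R) <= `|c| / n%:R by rewrite -mulNr ler_pM2r // -normrN ler_norm.
have M0 : 0 <= (`|w q| + M) / n%:R.
  by rewrite divr_ge0 // addr_ge0 // sumr_ge0.
have -> : (M + `|w q| + `|c|) / n%:R = (`|w q| + M) / n%:R + `|c| / n%:R.
  by rewrite [M + _]addrC mulrDl.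
by split; lra.
Qed.

End Fekete.

(** * Pressure of a two-variable word function *)

Section AbstractPressure.
Context {R : realType} {m : nat} (m_gt0 : (0 < m)%N).
Context (phi : seq 'I_m -> seq 'I_m -> R) (B c : R) (cF : seq 'I_m -> R)
  (phi_gt0 : forall K I, 0 < phi K I)
  (phi_ln : forall K I, `|ln (phi K I)| <= B * (size I).+1%:R)
  (c_gt0 : 0 < c)
  (phi_cat : forall K I J, phi K (I ++ J) <= c * phi K I * phi (K ++ I) J)
  (cF_ge0 : forall F, 0 <= cF F)
  (phi_prefix : forall F I, phi F I <= cF F * phi [::] (F ++ I))
  (phi_dominated : forall e, 0 < e ->
    exists C : R, exists s : seq (seq 'I_m), 0 < C /\
      forall K I, phi K I <= C * expR (e * (size I)%:R) * \sum_(F <- s) phi F I).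

(** In the application [phi K I] is the singular value function of [T_I^T P],
    where [P] is the projection onto [T_K^T W], so that this supremum is
    [psi T W s I]. *)
Definition sup_prefix (I : seq 'I_m) : R := sup (range (phi ^~ I)).

Lemma phi_le K I : phi K I <= expR (B * (size I).+1%:R).
Proof.
rewrite -[phi K I]lnK ?posrE // ler_expR.
exact: le_trans (ler_norm _) (phi_ln K I).
Qed.

Lemma phi_has_sup I : has_sup (range (phi ^~ I)).
Proof.
split; first by exists (phi [::] I), [::].
by exists (expR (B * (size I).+1%:R)) => _ [K _ <-]; exact: phi_le.
Qed.

Lemma phi_le_sup K I : phi K I <= sup_prefix I.
Proof. by apply: (ub_le_sup (phi_has_sup I).2); exists K. Qed.

Lemma sup_prefix_le I (x : R) : (forall K, phi K I <= x) -> sup_prefix I <= x.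
Proof.
by move=> xP; apply: ge_sup; [exact: (phi_has_sup I).1 | move=> _ [K _ <-]].
Qed.

Lemma sup_prefix_cat I J :
  sup_prefix (I ++ J) <= c * sup_prefix I * sup_prefix J.
Proof.
apply: sup_prefix_le => K; apply: le_trans (phi_cat K I J) _.
by apply: ler_pM; rewrite ?mulr_ge0 ?ler_pM2l ?phi_le_sup // ltW.
Qed.

Let S n := word_sum n (phi [::]).
Let Z n := word_sum n sup_prefix.

Lemma word_sum_phi_ge n : expR (- (B * n.+1%:R)) <= S n.
Proof.
apply: (@le_trans _ _ (word_sum n (fun _ : seq 'I_m => expR (- (B * n.+1%:R))))).
  rewrite word_sum_cst -[X in X <= _]mulr1n.
  by apply: ler_wpMn2l; rewrite ?expR_ge0 // expn_gt0 m_gt0.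
apply: ler_word_sum => I In; rewrite -[phi _ _]lnK ?posrE // ler_expR lerNl.
by rewrite -In; apply: le_trans (phi_ln [::] I); rewrite -normrN ler_norm.
Qed.

Lemma word_sum_phi_gt0 n : 0 < S n.
Proof. exact: lt_le_trans (expR_gt0 _) (word_sum_phi_ge n). Qed.

Lemma word_sum_phi_le n : S n <= Z n.
Proof. by apply: ler_word_sum => I _; exact: phi_le_sup. Qed.

Lemma word_sum_sup_gt0 n : 0 < Z n.
Proof. exact: lt_le_trans (word_sum_phi_gt0 n) (word_sum_phi_le n). Qed.

Lemma word_sum_sup_cat n l : Z (n + l) <= c * Z n * Z l.
Proof.
rewrite /Z word_sum_cat -(word_sumZ n c) -word_sumZr; apply: ler_word_sum => J _.
rewrite -word_sumZ; apply: ler_word_sum => L _; exact: sup_prefix_cat.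
Qed.

Lemma word_sum_phi_cat n l :
  S (n + l) <= c * expR (B * l.+1%:R) *+ (m ^ l) * S n.
Proof.
rewrite /S word_sum_cat -word_sumZ; apply: ler_word_sum => J _.
rewrite mulrnAl mulrAC -word_sum_cst; apply: ler_word_sum => L Ll.
apply: le_trans (phi_cat _ _ _) _; rewrite ler_pM2l ?mulr_gt0 // -Ll.
exact: phi_le.
Qed.

(** Dominate [phi K I] by the finitely many [phi F I], move [F] into the word by
    [phi_prefix], and drop the last [size F] letters by [word_sum_phi_cat]: this
    leads back to words of length [n] at the cost of a constant. *)
Lemma word_sum_sup_le e : 0 < e ->
  exists C : R, forall n, ln (Z n) <= C + e * n%:R + ln (S n).
Proof.
move=> e_gt0; have [C [s [C_gt0 sP]]] := phi_dominated e_gt0.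
pose D F := cF F * (c * expR (B * (size F).+1%:R) *+ (m ^ size F)).
have D_ge0 F : 0 <= D F.
  by rewrite mulr_ge0 // mulrn_wge0 // mulr_ge0 ?expR_ge0 // ltW.
pose C' := C * (\sum_(F <- s) D F + 1).
have C'_gt0 : 0 < C' by rewrite mulr_gt0 // ltr_wpDl // sumr_ge0.
exists (ln C') => n.
have le_Z : Z n <= C' * expR (e * n%:R) * S n.
  apply: (@le_trans _ _ (C * expR (e * n%:R) * \sum_(F <- s) D F * S n)).
    apply: (@le_trans _ _ (word_sum n (fun I =>
        C * expR (e * n%:R) * \sum_(F <- s) cF F * phi [::] (F ++ I)))).
      apply: ler_word_sum => I In; apply: sup_prefix_le => K.
      apply: le_trans (sP K I) _; rewrite In.
      rewrite ler_wpM2l ?mulr_ge0 ?expR_ge0 ?(ltW C_gt0) //.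
      by apply: ler_sum => F _.
    rewrite word_sumZ word_sum_sum.
    rewrite ler_wpM2l ?mulr_ge0 ?expR_ge0 ?(ltW C_gt0) //.
    apply: ler_sum => F _; rewrite word_sumZ /D -[X in _ <= X]mulrA.
    rewrite ler_wpM2l //.
    have phi_ge0 : forall I, 0 <= phi [::] I by move=> I; exact: ltW.
    apply: le_trans (word_sum_prefix F n phi_ge0) _; rewrite addnC.
    exact: word_sum_phi_cat.
  rewrite -mulr_suml mulrA ler_wpM2r ?(ltW (word_sum_phi_gt0 n)) // /C' mulrAC.
  by rewrite ler_wpM2r ?expR_ge0 // ler_wpM2l ?(ltW C_gt0) // lerDl.
have eS_gt0 : 0 < C' * expR (e * n%:R) by rewrite mulr_gt0 ?expR_gt0.
have S_gt0 := word_sum_phi_gt0 n.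
rewrite -{1}[e * _]expRK -lnM ?posrE ?expR_gt0 // -lnM ?posrE //.
by rewrite ler_ln ?posrE ?(mulr_gt0 eS_gt0) ?word_sum_sup_gt0.
Qed.

Lemma abstract_pressure : exists L : R,
  ((fun n => n%:R^-1 * ln (Z n)) @ \oo --> L) /\
  ((fun n => n%:R^-1 * ln (S n)) @ \oo --> L).
Proof.
have Z_sub n l : ln (Z (n + l)) <= ln (Z n) + ln (Z l) + ln c.
  rewrite addrC addrA -!lnM ?posrE ?mulr_gt0 ?word_sum_sup_gt0 //.
  by rewrite ler_ln ?posrE ?mulr_gt0 ?word_sum_sup_gt0 // word_sum_sup_cat.
have Z_ge n : - (B * n.+1%:R) <= ln (Z n).
  rewrite -[X in X <= _]expRK ler_ln ?posrE ?expR_gt0 ?word_sum_sup_gt0 //.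
  exact: le_trans (word_sum_phi_ge n) (word_sum_phi_le n).
have [L Z_cvg] := fekete Z_sub Z_ge; exists L; split.
  exact: cvgn_up_to_inverse Z_cvg.
apply: cvgn_up_to_inverse => e e_gt0.
have e2_gt0 : 0 < e / 2 by rewrite divr_gt0.
have [A ZA] := Z_cvg _ e2_gt0; have [C ZC] := word_sum_sup_le e2_gt0.
exists (A + `|C|) => n n_gt0; have := ZA n n_gt0; have := ZC n.
have nR : 0 < n%:R :> R by rewrite ltr0n.
have : ln (S n) <= ln (Z n).
  by rewrite ler_ln ?posrE ?word_sum_phi_gt0 ?word_sum_sup_gt0 ?word_sum_phi_le.
rewrite -(ler_pM2l (_ : 0 < n%:R^-1)) ?invr_gt0 // => SZ.
rewrite -(ler_pM2l (_ : 0 < n%:R^-1)) ?invr_gt0 // !mulrDr.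
rewrite [n%:R^-1 * (e / 2 * _)]mulrC mulfK ?gt_eqF // => ZS.
have C1 : n%:R^-1 * C <= `|C| / n%:R.
  by rewrite mulrC ler_pM2r ?invr_gt0 // ler_norm.
have C0 : 0 <= `|C| / n%:R by rewrite divr_ge0 // ltW.
rewrite mulrDl !ler_norml => /andP[Z1 Z2]; apply/andP; split; lra.
Qed.

End AbstractPressure.

(** * Products of the matrices along words *)

Lemma ln_le_ln_mul (R : realType) (x c y : R) : 0 < x -> 0 < c -> 0 < y ->
  x <= c * y -> ln x <= ln c + ln y.
Proof. by move=> x0 c0 y0 xy; rewrite -lnM ?posrE // ler_ln ?posrE ?mulr_gt0. Qed.

Lemma le_expR_mul (R : realType) (x u v y : R) : 0 < x -> 0 < y ->
  ln x <= u + v + ln y -> x <= expR u * expR v * y.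
Proof.
move=> x0 y0 xy; have e_gt0 : 0 < expR u * expR v by rewrite mulr_gt0 ?expR_gt0.
rewrite -ler_ln ?posrE ?(mulr_gt0 e_gt0) // (lnM (x := expR u * _)) ?posrE //.
by rewrite lnM ?posrE ?expR_gt0 // !expRK.
Qed.

(** After multiplication by [q] the total error is [2 * M * (n + 1)], which
    [2 * M <= e * q] absorbs. *)
Lemma ler_of_scaled (R : realType) (q M e n c x y g h : R) :
  1 <= q -> 0 <= n -> 2 * M <= e * q ->
  `|q * x - g| <= M * (n + 1) -> `|q * y - h| <= M * (n + 1) ->
  g <= c + h -> x <= e + `|c| + e * n + y.
Proof.
move=> q_ge1 n_ge0 Mq; rewrite !ler_norml => /andP[x1 x2] /andP[y1 y2] gh.
have q_gt0 : 0 < q by lra.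
have c1 : c <= q * `|c|.
  by apply: le_trans (ler_norm _) _; rewrite ler_peMl.
have n1_ge0 : 0 <= n + 1 by lra.
rewrite -(ler_pM2l q_gt0) !mulrDr.
have := ler_wpM2r n1_ge0 Mq; lra.
Qed.

Section WordMatrices.
Context {R : realType} {d m : nat}.
Context (T : 'I_m -> 'M[R]_d) (T_unit : forall i, T i \in unitmx).
Context (W : {vspace 'cV[R]_d}).
Implicit Types (I J K F : seq 'I_m).

Lemma word_prod_nil : word_prod T [::] = 1%:M.
Proof. by rewrite /word_prod big_nil. Qed.

Lemma word_prod_cons i I : word_prod T (i :: I) = T i *m word_prod T I.
Proof. by rewrite /word_prod big_cons. Qed.

Lemma word_prod_cat I J : word_prod T (I ++ J) = word_prod T I *m word_prod T J.
Proof.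
elim: I => [|i I IHI] /=; first by rewrite word_prod_nil mul1mx.
by rewrite !word_prod_cons IHI mulmxA.
Qed.

Lemma word_prod_unit I : word_prod T I \in unitmx.
Proof.
elim: I => [|i I IHI]; first by rewrite word_prod_nil unitmx1.
by rewrite word_prod_cons unitmx_mul T_unit.
Qed.

Definition word_space K := mx_image (word_prod T K)^T W.

(** [T_I^T] restricted to [T_K^T W]. Lengthening [I] multiplies on the left by a
    restriction to a further image of [W], see [word_restr_cat]. *)
Definition word_restr K I : 'M[R]_d :=
  (word_prod T I)^T *m ortho_proj (word_space K).

Lemma word_space_nil : word_space [::] = W.
Proof. by rewrite /word_space word_prod_nil trmx1 mx_image1. Qed.

Lemma dim_word_space K : \dim (word_space K) = \dim W.
Proof. by rewrite dim_mx_image // unitmx_tr word_prod_unit. Qed.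

Lemma word_space_cat K I :
  word_space (K ++ I) = mx_image (word_prod T I)^T (word_space K).
Proof. by rewrite /word_space mx_imageM word_prod_cat trmx_mul. Qed.

Lemma word_restr_cat K I J :
  word_restr K (I ++ J) = word_restr (K ++ I) J *m word_restr K I.
Proof.
rewrite /word_restr word_prod_cat trmx_mul -!mulmxA; congr (_ *m _).
by rewrite word_space_cat ortho_proj_image.
Qed.

Lemma word_restr_prefix F I :
  word_restr F I = word_restr [::] (F ++ I) *m
    (invmx (word_prod T F)^T *m ortho_proj (word_space F)).
Proof.
rewrite /word_restr word_prod_cat trmx_mul word_space_nil -!mulmxA.
congr (_ *m _); rewrite mulmxA ortho_proj_image_factor //.
by rewrite unitmx_tr word_prod_unit.
Qed.

(** Multiplying [word_restr K I] by the inverse of [T_I^T] gives back a projection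
    of rank [\dim W], whose minors of order at most [\dim W] do not all vanish. *)
Lemma minor_norm_word_restr j : (j <= \dim W)%N ->
  exists2 L : R, 0 <= L & forall K I,
    0 < minor_norm j (word_restr K I) /\
    `|ln (minor_norm j (word_restr K I))| <= L * (size I).+1%:R.
Proof.
move=> jW.
pose D : R := 1 + minor_bound d j +
  \sum_i (minor_norm j (T i) + minor_norm j (invmx (T i))).
have b_ge0 : 0 <= minor_bound d j :> R by rewrite /minor_bound.
have N_ge0 i : 0 <= minor_norm j (T i) + minor_norm j (invmx (T i)).
  by rewrite addr_ge0 ?minor_norm_ge0.
have sum_ge0 : 0 <= \sum_i (minor_norm j (T i) + minor_norm j (invmx (T i))).
  by rewrite sumr_ge0.
have D_ge1 : 1 <= D by rewrite /D; lra.
have D_gt0 : 0 < D by lra.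
have b_le : minor_bound d j <= D by rewrite /D; lra.
have T_le i : minor_norm j (T i) <= D /\ minor_norm j (invmx (T i)) <= D.
  have : minor_norm j (T i) + minor_norm j (invmx (T i)) <=
      \sum_i (minor_norm j (T i) + minor_norm j (invmx (T i))).
    by rewrite (bigD1 i) //= lerDl sumr_ge0.
  have := minor_norm_ge0 j (T i); have := minor_norm_ge0 j (invmx (T i)).
  by rewrite /D; split; lra.
have one_le : minor_norm j (1%:M : 'M[R]_d) <= D.
  apply: le_trans b_le; apply: minor_norm_le => a a'; rewrite mxE.
  by case: eqP; rewrite ?normr1 ?normr0.
have word_le I : minor_norm j (word_prod T I) <= D ^+ (size I).+1 /\
    minor_norm j (invmx (word_prod T I)) <= D ^+ (size I).+1.
  elim: I => [|i I [IH1 IH2]] /=.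
    by rewrite word_prod_nil expr1 invmx1.
  have [Ti1 Ti2] := T_le i.
  rewrite word_prod_cons exprS; split.
    by apply: le_trans (minor_norm_mul _ _ _) _; apply: ler_pM; rewrite ?minor_norm_ge0.
  have -> : invmx (T i *m word_prod T I) = invmx (word_prod T I) *m invmx (T i).
    have TI_unit : T i *m word_prod T I \in unitmx.
      by rewrite unitmx_mul T_unit word_prod_unit.
    apply: (can_inj (mulKmx TI_unit)); rewrite mulmxV // -mulmxA.
    by rewrite mulKVmx ?word_prod_unit // mulmxV ?T_unit.
  apply: le_trans (minor_norm_mul _ _ _) _; rewrite mulrC.
  by apply: ler_pM; rewrite ?minor_norm_ge0.
exists (2 * ln D) => [|K I]; first by rewrite mulr_ge0 // ln_ge0.
set P := ortho_proj (word_space K).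
have P_le : minor_norm j P <= D.
  apply: le_trans b_le; apply: minor_norm_le => a a'; exact: ortho_proj_entry.
have P_ge : 1 <= minor_norm j P.
  apply: minor_norm_idem_ge1; first exact: ortho_proj_idem.
  by apply: minor_norm_neq0; rewrite rank_ortho_proj dim_word_space.
have [wI wI'] := word_le I.
set x := minor_norm j (word_restr K I).
have x_le : x <= D ^+ (size I).+2.
  apply: le_trans (minor_norm_mul _ _ _) _; rewrite exprSr minor_norm_tr.
  by apply: ler_pM; rewrite ?minor_norm_ge0.
have x_ge : 1 <= D ^+ (size I).+1 * x.
  apply: le_trans P_ge _.
  have -> : P = (invmx (word_prod T I))^T *m word_restr K I.
    rewrite /word_restr mulmxA -trmx_mul mulmxV ?word_prod_unit //.
    by rewrite trmx1 mul1mx.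
  apply: le_trans (minor_norm_mul _ _ _) _; rewrite minor_norm_tr.
  by rewrite ler_wpM2r // minor_norm_ge0.
have Dn_gt0 : 0 < D ^+ (size I).+1 by rewrite exprn_gt0.
have x_gt0 : 0 < x by rewrite -(pmulr_rgt0 _ Dn_gt0) (lt_le_trans ltr01).
split=> //.
have lnD : 0 <= ln D by rewrite ln_ge0.
have up : ln x <= (size I).+2%:R * ln D.
  rewrite mulr_natl -lnXn // ler_ln ?posrE ?exprn_gt0 //.
have low : - ((size I).+1%:R * ln D) <= ln x.
  rewrite mulr_natl -lnXn //; rewrite -(ler_ln _ _) ?posrE ?ltr01 ?mulr_gt0 // in x_ge.
  by move: x_ge; rewrite ln1 lnM ?posrE //; lra.
have n0 : 0 <= (size I)%:R * ln D by rewrite mulr_ge0.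
move: up low; rewrite -!natr1 !mulrDl !mul1r ler_norml => up low.
by apply/andP; split; nra.
Qed.

(** The exponents [a] and [b] are approximated by [p / q] and [p' / q]: the
    [q]-th power of the left side is then a polynomial up to a factor
    [expR (O(n))], and taking [q]-th roots turns it into [expR (e * n)]. *)
Lemma minor_svf_dominated j j' (a b : R) :
  (j <= \dim W)%N -> (j' <= \dim W)%N -> 0 <= a -> 0 <= b ->
  forall e, 0 < e -> exists C : R, exists s : seq (seq 'I_m), 0 < C /\
    forall K I, minor_svf j j' a b (word_restr K I) <=
      C * expR (e * (size I)%:R) *
      \sum_(F <- s) minor_svf j j' a b (word_restr F I).
Proof.
move=> jW j'W a0 b0 e e_gt0.
have [L L_ge0 LP] := minor_norm_word_restr jW.
have [L' L'_ge0 LP'] := minor_norm_word_restr j'W.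
pose M := L + L'.
have M_ge0 : 0 <= M by rewrite addr_ge0.
pose q := (Num.bound (2 * M / e)).+1.
have q_ge1 : 1 <= q%:R :> R by rewrite ler1n.
have q_gt0 : 0 < q%:R :> R by lra.
have Mq : 2 * M <= e * q%:R.
  rewrite [e * _]mulrC -ler_pdivrMr //.
  have : 0 <= 2 * M / e by rewrite divr_ge0 ?mulr_ge0 // ltW.
  move=> /archi_boundP /ltW /le_trans; apply.
  by rewrite ler_nat.
pose p := Num.truncn (a * q%:R); pose p' := Num.truncn (b * q%:R).
have /andP[pa pa'] : p%:R <= a * q%:R < p.+1%:R by rewrite truncn_itv ?mulr_ge0 // ltW.
have /andP[pb pb'] : p'%:R <= b * q%:R < p'.+1%:R.
  by rewrite truncn_itv ?mulr_ge0 // ltW.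
have proj_le K i i' : `|ortho_proj (word_space K) i i'| <= 1.
  exact: ortho_proj_entry.
have [C [s [C_gt0 sP]]] := minor_norm_dominated j j' p p' proj_le.
exists (expR (e + `|ln C|)), s; split=> [|K I]; first exact: expR_gt0.
pose f F := minor_svf j j' a b (word_restr F I).
pose G F := minor_norm j (word_restr F I) ^+ p *
            minor_norm j' (word_restr F I) ^+ p'.
have G_gt0 F : 0 < G F.
  by rewrite mulr_gt0 // exprn_gt0 ?(LP F I).1 ?(LP' F I).1.
have f_gt0 F : 0 < f F by rewrite mulr_gt0 ?powR_gt0 ?(LP F I).1 ?(LP' F I).1.
have lnG F : `|q%:R * ln (f F) - ln (G F)| <= M * (size I).+1%:R.
  rewrite /f /G /minor_svf.
  have [x_gt0 x_le] := LP F I; have [y_gt0 y_le] := LP' F I.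
  set x := minor_norm j _ in x_gt0 x_le *; set y := minor_norm j' _ in y_gt0 y_le *.
  rewrite lnM ?posrE ?powR_gt0 // lnM ?posrE ?exprn_gt0 // !ln_powR !lnXn //.
  rewrite -[ln x *+ p]mulr_natl -[ln y *+ p']mulr_natl.
  have -> : q%:R * (a * ln x + b * ln y) - (p%:R * ln x + p'%:R * ln y) =
      (a * q%:R - p%:R) * ln x + (b * q%:R - p'%:R) * ln y by ring.
  apply: le_trans (ler_normD _ _) _; rewrite /M [(L + L') * _]mulrDl !normrM.
  have small (r t : R) : 0 <= r -> r <= 1 -> `|r| * `|t| <= `|t|.
    by move=> r0 r1; rewrite ger0_norm // ler_piMl.
  rewrite -natr1 in pa'; rewrite -natr1 in pb'.
  apply: lerD; first by apply: le_trans (small _ _ _ _) x_le; lra.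
  by apply: le_trans (small _ _ _ _) y_le; lra.
have [i i_lt Gi] := sP K (word_prod T I)^T (G_gt0 K).
set F := nth K s i in Gi.
have F_gt0 := G_gt0 F.
have {}Gi : ln (G K) <= ln C + ln (G F).
  exact: ln_le_ln_mul (G_gt0 K) C_gt0 F_gt0 Gi.
have f_le : f K <= expR (e + `|ln C|) * expR (e * (size I)%:R) * f F.
  apply: le_expR_mul (f_gt0 K) (f_gt0 F) _.
  have n_ge0 : 0 <= (size I)%:R :> R by [].
  move: (lnG K) (lnG F); rewrite -natr1 => lnGK lnGF.
  exact: ler_of_scaled q_ge1 n_ge0 Mq lnGK lnGF Gi.
apply: le_trans f_le _; rewrite ler_wpM2l ?mulr_ge0 ?expR_ge0 //.
rewrite (big_nth K) big_mkord (bigD1 (Ordinal i_lt)) //= lerDl sumr_ge0 // => l _.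
exact: minor_svf_ge0.
Qed.

End WordMatrices.

(** * The pressure along orbits of a subspace *)

Section Pressure.
Context {R : realType} {d m : nat}.
Context (T : 'I_m -> 'M[R]_d) (T_unit : forall i, T i \in unitmx).
Context (W : {vspace 'cV[R]_d}) (Wd : (\dim W < d)%N) (s : R).

Local Notation restr := (word_restr T W).

Lemma psiE (I : seq 'I_m) :
  psi T W s I = ereal_sup (range (fun K => (svf s (restr K I))%:E)).
Proof. by []. Qed.

Lemma phi_seqE (n : nat) :
  phi_seq T W s n =
  (n%:R^-1%:E * lne (word_sum n (fun I => svf s (restr [::] I)))%:E)%E.
Proof.
rewrite /phi_seq -[word_sum _ _]tuple_word_sum.
by under [in RHS]eq_bigr => I _ do rewrite /word_restr word_space_nil.
Qed.

(** The matrices [T_I^T P] have rank at most [\dim W], which is less than [s]; their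
    singular value functions vanish. *)
Lemma pressure_degenerate : (\dim W)%:R < s ->
  (psi_seq T W s @ \oo --> -oo%E) /\ (phi_seq T W s @ \oo --> -oo%E).
Proof.
move=> ks.
have svf0 K I : svf s (restr K I) = 0.
  apply: (svf_eq0 ks Wd); apply: leq_trans (mxrankM_maxr _ _) _.
  by rewrite rank_ortho_proj dim_word_space.
have psi0 I : psi T W s I = 0%E.
  rewrite psiE -[RHS](ereal_sup1 0%E); congr ereal_sup.
  apply/seteqP; split=> [_ [K _ <-]|_ ->]; first by rewrite /= svf0.
  by exists [::] => //; rewrite svf0.
have n_gt0 n : (0 < n)%N -> (0 < (n%:R^-1 : R)%:E)%E.
  by move=> n0; rewrite lte_fin invr_gt0 ltr0n.
split; apply: cvg_near_cst; exists 1%N => // n /= n1.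
  rewrite /psi_seq big1 ?le0_lneNy ?gt0_muleNy ?n_gt0 // => I _; exact: psi0.
by rewrite phi_seqE -tuple_word_sum big1 ?le0_lneNy ?gt0_muleNy ?n_gt0.
Qed.

Lemma pressure_regular : (0 < m)%N -> 0 <= s <= (\dim W)%:R ->
  exists L : R, (psi_seq T W s @ \oo --> L%:E) /\
                (phi_seq T W s @ \oo --> L%:E).
Proof.
move=> m_gt0 sW.
have [j [j' [a [b [c [[jW j'W] [a0 b0] c_gt0 svfP]]]]]] := svf_minor_svf sW Wd.
pose ms := minor_svf j j' a b : 'M[R]_d -> R.
have svf_le A : svf s A <= c * ms A := (svfP A).1.
have ms_le A : ms A <= c * svf s A := (svfP A).2.
have c0 : 0 <= c := ltW c_gt0.
have ms_ge0 A : 0 <= ms A := minor_svf_ge0 j j' a b A.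
have svf_ge0 (A : 'M[R]_d) : 0 <= svf s A.
  by rewrite -(pmulr_rge0 _ c_gt0) (le_trans (ms_ge0 A)).
have svf_mul (A A' : 'M[R]_d) : svf s (A *m A') <= c ^+ 3 * svf s A' * svf s A.
  have -> : c ^+ 3 * svf s A' * svf s A = c * ((c * svf s A) * (c * svf s A')).
    by ring.
  apply: le_trans (svf_le _) _; rewrite ler_pM2l //.
  by apply: le_trans (minor_svf_mul j j' A A' a0 b0) _; apply: ler_pM.
have [L L_ge0 LP] := minor_norm_word_restr T_unit jW.
have [L' L'_ge0 LP'] := minor_norm_word_restr T_unit j'W.
pose phi K I := svf s (restr K I).
have ms_gt0 K I : 0 < ms (restr K I).
  by rewrite mulr_gt0 ?powR_gt0 ?(LP K I).1 ?(LP' K I).1.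
have phi_gt0 K I : 0 < phi K I.
  by rewrite -(pmulr_rgt0 _ c_gt0); exact: lt_le_trans (ms_gt0 K I) (ms_le _).
have ln_ms K I : `|ln (ms (restr K I))| <= (a * L + b * L') * (size I).+1%:R.
  have [x_gt0 x_le] := LP K I; have [y_gt0 y_le] := LP' K I.
  rewrite /ms /minor_svf (lnM (x := _ `^ a)) ?posrE ?powR_gt0 // !ln_powR.
  apply: le_trans (ler_normD _ _) _.
  rewrite !normrM (ger0_norm a0) (ger0_norm b0) mulrDl.
  by rewrite -!mulrA; apply: lerD; apply: ler_wpM2l.
have phi_ln K I :
    `|ln (phi K I)| <= (a * L + b * L' + `|ln c|) * (size I).+1%:R.
  have ln1 := ln_le_ln_mul (phi_gt0 K I) c_gt0 (ms_gt0 K I) (svf_le _).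
  have ln2 := ln_le_ln_mul (ms_gt0 K I) c_gt0 (phi_gt0 K I) (ms_le _).
  have n_ge1 : 1 <= (size I).+1%:R :> R by rewrite ler1n.
  have lnc : `|ln c| <= `|ln c| * (size I).+1%:R by rewrite ler_peMr.
  move: (ln_ms K I) (ler_norm (ln c)) ln1 ln2; rewrite mulrDl !ler_norml.
  by move=> /andP[m1 m2] n1 ln1 ln2; apply/andP; split; lra.
have c3_gt0 : 0 < c ^+ 3 by rewrite exprn_gt0.
have phi_cat K I J : phi K (I ++ J) <= c ^+ 3 * phi K I * phi (K ++ I) J.
  by rewrite /phi word_restr_cat //; exact: svf_mul.
pose cF F := c ^+ 3 *
  svf s (invmx (word_prod T F)^T *m ortho_proj (word_space T W F)).
have cF_ge0 F : 0 <= cF F by rewrite mulr_ge0 ?svf_ge0 // ltW.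
have phi_prefix F I : phi F I <= cF F * phi [::] (F ++ I).
  by rewrite /phi /cF word_restr_prefix //; exact: svf_mul.
have phi_dominated e : 0 < e ->
    exists C : R, exists r : seq (seq 'I_m), 0 < C /\
      forall K I, phi K I <= C * expR (e * (size I)%:R) * \sum_(F <- r) phi F I.
  move=> e_gt0.
  have [C [r [C_gt0 rP]]] := minor_svf_dominated T_unit jW j'W a0 b0 e_gt0.
  exists (c * C * c), r; split=> [|K I]; first by rewrite !mulr_gt0.
  apply: le_trans (svf_le _) _.
  have -> : c * C * c * expR (e * (size I)%:R) * (\sum_(F <- r) phi F I) =
      c * (C * expR (e * (size I)%:R) * (\sum_(F <- r) c * phi F I)).
    by rewrite -mulr_sumr; ring.
  rewrite ler_pM2l //; apply: le_trans (rP K I) _.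
  rewrite ler_pM2l ?mulr_gt0 ?expR_gt0 //; apply: ler_sum => F _; exact: ms_le.
have [P [Zcvg Scvg]] := abstract_pressure m_gt0 phi_gt0 phi_ln c3_gt0 phi_cat
  cF_ge0 phi_prefix phi_dominated.
have to_EFin (u : nat -> R) : (u @ \oo --> P) -> ((fun n => (u n)%:E) @ \oo --> P%:E).
  move=> u_cvg; apply/fine_cvgP; split; first by exists 0%N.
  exact: u_cvg.
exists P; split.
  have -> : psi_seq T W s = (fun n => (n%:R^-1 * ln (word_sum n (sup_prefix phi)))%:E).
    apply/funext => n; rewrite /psi_seq.
    have psi_sup I : psi T W s I = (sup_prefix phi I)%:E.
      have [ne ub] := phi_has_sup phi_gt0 phi_ln I.
      by rewrite psiE -ereal_sup_EFin // image_comp.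
    under eq_bigr => I _ do rewrite psi_sup.
    rewrite sumEFin tuple_word_sum lne_EFin -?EFinM //.
    exact: (word_sum_sup_gt0 m_gt0 phi_gt0 phi_ln).
  exact: to_EFin.
have -> : phi_seq T W s = (fun n => (n%:R^-1 * ln (word_sum n (phi [::])))%:E).
  apply/funext => n; rewrite phi_seqE lne_EFin -?EFinM //.
  exact: (word_sum_phi_gt0 m_gt0 phi_gt0 phi_ln).
exact: to_EFin.
Qed.

End Pressure.

Unset Implicit Arguments.

Theorem proposition4p4 (R : realType) (d m k : nat)
    (hd : (2 <= d)%N) (hm : (1 <= m)%N) (hk : (1 <= k <= d - 1)%N)
    (T : 'I_m -> 'M[R]_d)
    (T_unit : forall i : 'I_m, T i \in unitmx)
    (T_contr : forall i : 'I_m, opnorm (T i) < 1)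
    (s : R) (hs : 0 <= s)
    (W : {vspace 'cV[R]_d}) (hW : \dim W = k) :
  [/\ cvgn (psi_seq T W s),
      cvgn (phi_seq T W s),
      pressure T W s = limn (phi_seq T W s)
    & (limn (phi_seq T W s) < +oo)%E].
Proof.
have Wd : (\dim W < d)%N.
  have /andP[_] := hk; rewrite hW -ltnS => /leq_trans; apply.
  by rewrite subn1 prednK // (leq_trans _ hd).
suff [L [psi_cvg phi_cvg L_fin]] : exists L : \bar R,
    [/\ psi_seq T W s @ \oo --> L, phi_seq T W s @ \oo --> L & (L < +oo)%E].
  have psi_lim := cvg_lim (@ereal_hausdorff R) psi_cvg.
  have phi_lim := cvg_lim (@ereal_hausdorff R) phi_cvg.
  split; [exact: cvgP psi_cvg | exact: cvgP phi_cvg | | by rewrite phi_lim].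
  by rewrite /pressure psi_lim phi_lim.
have [s_le|s_gt] := leP s (\dim W)%:R.
  have sW : 0 <= s <= (\dim W)%:R by rewrite hs.
  have [L [psi_cvg phi_cvg]] := pressure_regular T_unit Wd hm sW.
  by exists L%:E; split=> //; rewrite ltry.
have [psi_cvg phi_cvg] := pressure_degenerate T_unit Wd s_gt.
by exists -oo%E; split=> //; exact: ltNye.
Qed.
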